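(* Let $d\ge1$ be an integer, and let $L,\beta,\alpha$ be positive constants. Let $\mathcal{P}'_\Sigma$ be the class of probability distributions defined in the context. Then there exists a constant $C>0$ such that for any $n\ge1$ and any classifier $\hat f_n:\mathcal{Z}^n\to\mathcal{F}$ we have $$\sup_{P\in\mathcal{P}'_\Sigma}\{\mathbf{E}R(\hat f_n)-R(f^* )\}\ge C\,n^{-(1+\alpha)\beta/((2+\alpha)\beta+d)}.$$
   Context: $(X,Y)\sim P$ takes values in $\mathcal{Z}=\mathbf{R}^d\times\{0,1\}$; $P_X$ is the law of $X$; $\eta(x)=P(Y=1\mid X=x)$. $\mathcal{F}$ is the set of Borel functions $f:\mathbf{R}^d\to\{0,1\}$. A classifier $\hat f_n:\mathcal{Z}^n\to\mathcal{F}$ is a mapping, measurable with respect to the sample, applied to the i.i.d. sample $(X_i,Y_i)_{i=1}^n$ with law $P^{\otimes n}$; $\mathbf{E}$ is expectation over the sample. $R(f)=P(Y\ne f(X))$ with $(X,Y)$ independent of the sample; $f^*(x)=\mathbb{1}_{\{\eta(x)\ge1/2\}}$. $\|\cdot\|$ is the Euclidean norm, $\mathcal{B}(x,r)$ the closed Euclidean ball of center $x$ and radius $r$, $\lambda$ the Lebesgue measure. Class $\mathcal{P}'_\Sigma$: for the parameter $\alpha$, fixed positive parameters $c_0,r_0,C_0,\beta,L,\mu_{\max}$ and a fixed compact $\mathcal{C}\subset\mathbf{R}^d$, $\mathcal{P}'_\Sigma$ is the class of all probability distributions $P$ on $\mathcal{Z}$ such that (i) (margin assumption) $P_X(0<|\eta(X)-1/2|\le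 t)\le C_0t^\alpha$ for all $t>0$; (ii) $\eta$ belongs to the Hölder class $\Sigma(\beta,L,\mathbf{R}^d)$: with $\lfloor\beta\rfloor$ the maximal integer strictly less than $\beta$, this is the set of $g:\mathbf{R}^d\to\mathbf{R}$ that are $\lfloor\beta\rfloor$ times continuously differentiable and satisfy $|g(x')-g_x(x')|\le L\|x'-x\|^\beta$ for all $x,x'\in\mathbf{R}^d$, where $g_x(x')=\sum_{|s|\le\lfloor\beta\rfloor}\frac{(x'-x)^s}{s!}D^sg(x)$ (multi-index notation) is the Taylor polynomial of degree $\lfloor\beta\rfloor$ at $x$; (iii) (mild density assumption) $P_X$ is supported on a compact $A\subseteq\mathcal{C}$ that is $(c_0,r_0)$-regular, i.e. $\lambda[A\cap\mathcal{B}(x,r)]\ge c_0\lambda[\mathcal{B}(x,r)]$ for all $0<r\le r_0$ and $x\in A$, and $P_X$ has a uniformly bounded Lebesgue density $\mu$: $\mu(x)\le\mu_{\max}$ for all $x\in A$.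
   Formalization: The fixed parameters are assumed to admit a compact (c_0,r_0)-regular A inside the compact C with mu_max·λ(A) > 1; otherwise the class is empty, or P_X is forced to be uniform on A, where faster rates hold and the claimed bound fails. *)

(* Defs.v *)
From HB Require Import structures.
From mathcomp Require Import all_boot all_order all_algebra.
From mathcomp Require Import all_classical all_reals all_analysis.
From mathcomp Require Import measurable_realfun.

Set Implicit Arguments.
Unset Strict Implicit.
Unset Printing Implicit Defensive.

Import Order.TTheory GRing.Theory Num.Theory.
Import numFieldNormedType.Exports.

Local Open Scope classical_set_scope.
Local Open Scope ring_scope.

Section product_power.
Local Open Scope ereal_scope.
Context {disp : measure_display} {T : measurableType disp} {R : realType}.

Definition tcons n (p : T * n.-tuple T) : n.+1.-tuple T :=
  [the n.+1.-tuple T of p.1 :: p.2].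

Lemma measurable_tcons n : measurable_fun setT (@tcons n).
Proof. exact: measurable_cons. Qed.

(* The n-fold product of mu with itself, on n.-tuple T with the product
   sigma-algebra *)
Fixpoint mpower (mu : set T -> \bar R) (n : nat) :
    set (n.-tuple T) -> \bar R :=
  if n is n'.+1 then pushforward (mu \x @mpower mu n') (@tcons n')
  else \d_[tuple].

End product_power.
Arguments mpower {disp T R} mu n _ : rename.

Section mpower_step.
Local Open Scope ereal_scope.
Context {disp : measure_display} {T : measurableType disp} {R : realType}.
Variables (n : nat).

Let tuncons (t : n.+1.-tuple T) : T * n.-tuple T := (thead t, [tuple of behead t]).

Let measurable_tuncons : measurable_fun setT tuncons.
Proof.
by apply: measurable_fun_pair; [exact: measurable_tnth|exact: measurable_behead].
Qed.

Let tunconsK : cancel tuncons (@tcons _ T n).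
Proof. by move=> t; apply/val_inj; rewrite [in RHS](tuple_eta t). Qed.

Let tconsK : cancel (@tcons _ T n) tuncons.
Proof. by move=> [x t]; congr pair; apply/val_inj. Qed.

Section sigma_finite.
Variables (mu : {sigma_finite_measure set T -> \bar R}).
Variables (m : {sigma_finite_measure set (n.-tuple T) -> \bar R}).

Definition mcons := pushforward (mu \x m) (@tcons _ T n).

Let mcons0 : mcons set0 = 0.
Proof. by rewrite /mcons /pushforward preimage_set0 measure0. Qed.

Let mcons_ge0 A : 0 <= mcons A.
Proof. exact: (measure_ge0 (mu \x m)). Qed.

Let mcons_sigma_additive : semi_sigma_additive mcons.
Proof.
exact: (@measure_semi_sigma_additive _ _ _
  (measure_function_pushforward__canonical__measure_function_Measure
    (mu \x m) (@measurable_tcons _ T n))).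
Qed.

HB.instance Definition _ := isMeasure.Build _ _ _ mcons
  mcons0 mcons_ge0 mcons_sigma_additive.

Let mcons_sigma_finite : sigma_finite setT mcons.
Proof.
have /sigma_finiteP[F [TF ndF Foo]] := sigma_finiteT mu.
have /sigma_finiteP[G [TG ndG Goo]] := sigma_finiteT m.
exists (fun i => tuncons @^-1` (F i `*` G i)).
  rewrite -preimage_bigcup; apply/seteqP; split => // t _ /=.
  have [i _ Fi] : (\bigcup_i F i) (thead t) by rewrite -TF.
  have [j _ Gj] : (\bigcup_i G i) [tuple of behead t] by rewrite -TG.
  exists (maxn i j) => //; split.
    exact: (subsetPset _ _ (ndF _ _ (leq_maxl i j))).
  exact: (subsetPset _ _ (ndG _ _ (leq_maxr i j))).
move=> i; have [mF Fi] := Foo i; have [mG Gi] := Goo i; split.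
  rewrite -[X in measurable X]setTI.
  by apply: measurable_tuncons => //; exact: measurableX.
rewrite /mcons /pushforward -comp_preimage.
rewrite (_ : _ \o _ = id); last by apply/funext => p; exact: tconsK.
by rewrite preimage_id product_measure1E// lte_mul_pinfty// ge0_fin_numE.
Qed.

HB.instance Definition _ := Measure_isSigmaFinite.Build _ _ _ mcons
  mcons_sigma_finite.

End sigma_finite.

End mpower_step.

Section mpower_measure.
Local Open Scope ereal_scope.
Context {disp : measure_display} {T : measurableType disp} {R : realType}.
Variables (mu : {sigma_finite_measure set T -> \bar R}) (n : nat).

Let bundle : exists m : {sigma_finite_measure set (n.-tuple T) -> \bar R},
  mpower mu n = m.
Proof.
elim: n => [|k [m IH]].
  by exists (\d_[tuple] : {sigma_finite_measure set (0.-tuple T) -> \bar R}).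
by exists (mcons mu m); rewrite /= IH.
Qed.

Let mpower0 : mpower mu n set0 = 0.
Proof. by case: bundle => m ->; rewrite measure0. Qed.

Let mpower_ge0 A : 0 <= mpower mu n A.
Proof. by case: bundle => m ->; exact: (measure_ge0 m). Qed.

Let mpower_sigma_additive : semi_sigma_additive (mpower mu n).
Proof. by case: bundle => m ->; exact: measure_semi_sigma_additive. Qed.

HB.instance Definition _ := isMeasure.Build _ _ _ (mpower mu n)
  mpower0 mpower_ge0 mpower_sigma_additive.

Let mpower_sigma_finite : sigma_finite setT (mpower mu n).
Proof. by case: bundle => m ->; exact: sigma_finiteT. Qed.

HB.instance Definition _ := Measure_isSigmaFinite.Build _ _ _ (mpower mu n)
  mpower_sigma_finite.

End mpower_measure.

Section mpower_theory.
Local Open Scope ereal_scope.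
Context {disp : measure_display} {T : measurableType disp} {R : realType}.

Lemma mpower_box (mu : {sigma_finite_measure set T -> \bar R}) n
    (A : 'I_n -> set T) : (forall i, measurable (A i)) ->
  mpower mu n [set t | forall i, A i (tnth t i)] = \prod_(i < n) mu (A i).
Proof.
elim: n A => [|n IH] A mA.
  rewrite big_ord0 /= diracE mem_set//= => -[].
  by [].
rewrite big_ord_recl -IH; last by move=> i; exact: mA.
rewrite -product_measure1E//=; last first.
  rewrite (_ : [set _ | _] = \bigcap_(i in [set: 'I_n])
      ((fun t : n.-tuple T => tnth t i) @^-1` A (lift ord0 i))).
    apply: fin_bigcap_measurable => // i _.
    by rewrite -[X in measurable X]setTI; exact: measurable_tnth.
  by apply/seteqP; split => [t /= At i _|t At i]; exact: At.
rewrite /pushforward; congr ((_ \x _) _); apply/seteqP; split => [[x t]/= h|[x t]/= [Ax At] i].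
  split; first exact: (h ord0).
  by move=> i; have := h (lift ord0 i); rewrite tnthS.
have [->//|i0] := eqVneq i ord0.
have [j ->] : exists j, i = lift ord0 j.
  by case: (unliftP ord0 i) i0 => [j ->|->]; [exists j|rewrite eqxx].
by rewrite tnthS.
Qed.

End mpower_theory.

Section mpower_probability.
Local Open Scope ereal_scope.
Context {disp : measure_display} {T : measurableType disp} {R : realType}.
Variables (P : probability T R) (n : nat).

Let mpower_setT : mpower P n setT = 1.
Proof.
have /= := @mpower_box _ _ _ P n (fun=> setT) (fun=> measurableT).
rewrite big1 => [<-|i _]; last exact: probability_setT.
by congr mpower; apply/seteqP; split.
Qed.

HB.instance Definition _ := Measure_isProbability.Build _ _ _ (mpower P n)
  mpower_setT.

End mpower_probability.

Section borel.
Context {R : realType} {d : nat}.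

HB.instance Definition _ := @isMeasurable.Build (sigma_display (@open 'rV[R]_d))
  'rV[R]_d <<s @open 'rV[R]_d >> (@sigma_algebra0 _ setT _)
  (@sigma_algebraC _ _) (@sigma_algebra_bigcup _ setT _).

Definition row_of_tuple (t : d.-tuple (measurableTypeR R)) : 'rV[R]_d :=
  \row_i tnth t i.

Lemma measurable_row_of_tuple : measurable_fun setT row_of_tuple.
Proof.
apply: (@measurability _ _ _ _ _ _ (@open 'rV[R]_d)) => //.
move=> _ [U oU <-]; rewrite setTI.
pose bx (p : 'rV[rat]_d * nat) : set 'rV[R]_d :=
  [set x | forall i, ball (ratr (p.1 ord0 i) : R) p.2.+1%:R^-1 (x ord0 i)].
have -> : U = \bigcup_p (if `[< bx p `<=` U >] then bx p else set0).
  apply/seteqP; split => [x Ux|x [p _]]; last by case: asboolP => // + xp; exact.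
  have /nbhs_ballP[e /= e0 xeU] : nbhs x U by exact: open_nbhs_nbhs.
  have [k ke] : exists k, k.+1%:R^-1 < e / 2 :> R.
    have e20 : 0 < e / 2 by rewrite divr_gt0.
    by have [k _ /(_ k (leqnn k)) ?] := near_infty_natSinv_lt (PosNum e20); exists k.
  have qP i : exists q : rat, `|ratr q - x ord0 i| < k.+1%:R^-1.
    have [|q] := @rat_in_itvoo R (x ord0 i - k.+1%:R^-1) (x ord0 i + k.+1%:R^-1).
      by rewrite ltrBlDr -addrA ltrDl addr_gt0// invr_gt0.
    by rewrite in_itv/= -ltr_distl => ?; exists q.
  pose q : 'rV[rat]_d := \row_i sval (cid (qP i)).
  exists (q, k) => //; case: asboolP => [_ i|[]].
    by rewrite /ball/= mxE; exact: svalP (cid (qP i)).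
  move=> y qy; apply: xeU; split => // i j; rewrite ord1.
  rewrite /ball/= (splitr e) (le_lt_trans (ler_distD (ratr (q ord0 j)) _ _))//.
  rewrite ltrD// (lt_trans _ ke)//; last exact: qy.
  by rewrite distrC mxE; exact: svalP (cid (qP j)).
rewrite preimage_bigcup; apply: countable_bigcupT_measurable => // p.
case: asboolP => _; last by rewrite preimage_set0.
rewrite (_ : _ @^-1` _ = \bigcap_(i in [set: 'I_d])
  ((fun t : d.-tuple (measurableTypeR R) => tnth t i) @^-1`
     ball (ratr (p.1 ord0 i) : R) p.2.+1%:R^-1)).
  apply: fin_bigcap_measurable => // i _.
  rewrite -[X in measurable X]setTI; apply: measurable_tnth => //.
  exact: measurable_ball.
by apply/seteqP; split => [t /= h i _|t h i]; have := h i; rewrite !mxE; exact.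
Qed.

Lemma measurable_coord (i : 'I_d) :
  measurable_fun setT (fun x : 'rV[R]_d => x ord0 i).
Proof.
apply: (measurability _ (RGenOInfty.measurableE R)) => //.
move=> _ [_ [a ->] <-]; rewrite setTI; apply: sub_sigma_algebra.
apply: open_comp; last exact: interval_open.
by move=> x _; exact: coord_continuous.
Qed.

End borel.

Section lebesgue.
Local Open Scope ereal_scope.
Context {R : realType} {d : nat}.

Definition lebesgue_rV : set 'rV[R]_d -> \bar R :=
  pushforward (mpower (@lebesgue_measure R) d) row_of_tuple.

Let lebesgue_rV0 : lebesgue_rV set0 = 0.
Proof. by rewrite /lebesgue_rV /pushforward preimage_set0 measure0. Qed.

Let lebesgue_rV_ge0 A : 0 <= lebesgue_rV A.
Proof. exact: (measure_ge0 (mpower (@lebesgue_measure R) d)). Qed.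

Let lebesgue_rV_sigma_additive : semi_sigma_additive lebesgue_rV.
Proof.
exact: (@measure_semi_sigma_additive _ _ _
  (measure_function_pushforward__canonical__measure_function_Measure
    (mpower (@lebesgue_measure R) d) measurable_row_of_tuple)).
Qed.

HB.instance Definition _ := isMeasure.Build _ _ _ lebesgue_rV
  lebesgue_rV0 lebesgue_rV_ge0 lebesgue_rV_sigma_additive.

Lemma lebesgue_rV_box (a b : 'I_d -> R) : (forall i, (a i <= b i)%R) ->
  lebesgue_rV [set x | forall i, (a i <= x ord0 i <= b i)%R] =
  (\prod_(i < d) (b i - a i))%:E.
Proof.
move=> ab; rewrite /lebesgue_rV /pushforward.
rewrite (_ : _ @^-1` _ =
    [set t | forall i, [set` `[a i, b i]] (tnth t i)]); last first.
  by apply/seteqP; split => t /= h i; have := h i; rewrite mxE in_itv.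
have -> := @mpower_box _ _ _ (@lebesgue_measure R) d (fun i => [set` `[a i, b i]])
  (fun i => measurable_itv _).
rewrite -prodEFin; apply: eq_bigr => i _.
rewrite [LHS]lebesgue_measure_itv/= lte_fin.
have := ab i; rewrite le_eqVlt => /predU1P[->|->//].
by rewrite ltxx subrr.
Qed.

Let lebesgue_rV_sigma_finite : sigma_finite setT lebesgue_rV.
Proof.
exists (fun k : nat =>
    [set x : 'rV[R]_d | forall i, (- k%:R <= x ord0 i <= k%:R)%R]).
  apply/esym; rewrite -subTset => x _.
  exists (Num.truncn (\sum_i `|x ord0 i|)%R).+1 => //= i.
  rewrite -ler_norml ltW// (le_lt_trans _ (truncnS_gt _))//.
  by rewrite (bigD1 i)//= lerDl sumr_ge0.
move=> k; split; last first.
  by rewrite lebesgue_rV_box ?ltry// => i; rewrite lerNl (le_trans _ (ler0n _ _))// oppr_le0.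
rewrite (_ : [set _ | _] = \bigcap_(i in [set: 'I_d])
    ((fun x : 'rV[R]_d => x ord0 i) @^-1` [set` `[(- k%:R)%R, k%:R%R]])).
  apply: fin_bigcap_measurable => // i _.
  by rewrite -[X in measurable X]setTI; exact: measurable_coord.
apply/seteqP; split => [x /= h i _|x h i]; first by rewrite /= in_itv/=; exact: h.
by have := h i I; rewrite /= in_itv.
Qed.

HB.instance Definition _ := Measure_isSigmaFinite.Build _ _ _ lebesgue_rV
  lebesgue_rV_sigma_finite.

End lebesgue.

Section euclidean.
Context {R : realType} {d : nat}.
Implicit Types (x y : 'rV[R]_d) (g : 'rV[R]_d -> R).

(* The library norm on 'rV[R]_d is the sup norm. *)
Definition enorm x : R := Num.sqrt (\sum_i x ord0 i ^+ 2).

Definition eball x (r : R) : set 'rV[R]_d := [set y | enorm (y - x) <= r].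

Definition partial (i : 'I_d) g : 'rV[R]_d -> R := 'D_(delta_mx ord0 i) g.

Fixpoint Ck (k : nat) g : Prop :=
  if k is k'.+1 then
    [/\ continuous g,
        forall i x, derivable g x (delta_mx ord0 i) &
        forall i, Ck k' (partial i g)]
  else continuous g.

(* D^s g *)
Definition mpartial (s : 'I_d -> nat) g : 'rV[R]_d -> R :=
  foldr (fun i h => iter (s i) (partial i) h) g (enum 'I_d).

(* A multi-index s with |s| <= k has all its entries at most k. *)
Definition taylor (k : nat) g x x' : R :=
  \sum_(s : {ffun 'I_d -> 'I_k.+1} | (\sum_i s i <= k)%N)
    (\prod_i (x' ord0 i - x ord0 i) ^+ s i) / (\prod_i (s i)`!)%:R *
    mpartial (fun i => s i) g x.

End euclidean.

(* The largest integer strictly less than b, for 0 < b *)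
Definition strict_floor {R : realType} (b : R) : nat := `|Num.ceil b|%N.-1.

Lemma strict_floorP {R : realType} (b : R) : 0 < b ->
  (strict_floor b)%:R < b <= (strict_floor b).+1%:R.
Proof.
move=> b0; have c0 : 0 < Num.ceil b by rewrite ceil_gt0.
have := ceil_itv b; rewrite /strict_floor; case: (Num.ceil b) c0 => [[|n]|]//= _.
by rewrite intrB rmorph1 -natr1 -pmulrn -natr1 addrK.
Qed.

Definition holder {R : realType} {d : nat} (beta L : R) (g : 'rV[R]_d -> R) :=
  Ck (strict_floor beta) g /\
  forall x x', `|g x' - taylor (strict_floor beta) g x x'|
    <= L * enorm (x' - x) `^ beta.

Section classification.
Local Open Scope ereal_scope.
Context {R : realType} {d : nat}.
Local Notation Z := ('rV[R]_d * bool)%type.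
Implicit Types (P : probability Z R) (eta : 'rV[R]_d -> R).

(* The law P_X of X when (X, Y) has law P *)
Definition marginal P : set 'rV[R]_d -> \bar R := pushforward P fst.

Section marginal_probability.
Variable P : probability Z R.

Let marginal0 : marginal P set0 = 0.
Proof. by rewrite /marginal /pushforward preimage_set0 measure0. Qed.

Let marginal_ge0 A : 0 <= marginal P A.
Proof. exact: (measure_ge0 P). Qed.

Let marginal_sigma_additive : semi_sigma_additive (marginal P).
Proof.
exact: (@measure_semi_sigma_additive _ _ _
  (measure_function_pushforward__canonical__measure_function_Measure
    P measurable_fst)).
Qed.

HB.instance Definition _ := isMeasure.Build _ _ _ (marginal P)
  marginal0 marginal_ge0 marginal_sigma_additive.

Let marginal_setT : marginal P setT = 1.
Proof. by rewrite /marginal /pushforward preimage_setT probability_setT. Qed.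

HB.instance Definition _ := Measure_isProbability.Build _ _ _ (marginal P)
  marginal_setT.

End marginal_probability.

(* eta is a version of x |-> P(Y = 1 | X = x). *)
Definition regression P eta :=
  [/\ measurable_fun setT eta,
      forall x, (0 <= eta x <= 1)%R &
      forall B, measurable B ->
        P (B `*` [set true]) = \int[marginal P]_(x in B) (eta x)%:E].

Definition margin (alpha C0 : R) P eta :=
  forall t : R, (0 < t)%R ->
    marginal P [set x | (0 < `|eta x - 1 / 2| <= t)%R] <= (C0 * t `^ alpha)%:E.

Definition regular (c0 r0 : R) (A : set 'rV[R]_d) :=
  forall r x, (0 < r <= r0)%R -> A x ->
    c0%:E * lebesgue_rV (eball x r) <= lebesgue_rV (A `&` eball x r).

Definition mild_density (c0 r0 mumax : R) (K : set 'rV[R]_d) P :=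
  exists A : set 'rV[R]_d,
    [/\ compact A, A `<=` K, regular c0 r0 A, marginal P A = 1 &
      exists mu : 'rV[R]_d -> R,
        [/\ measurable_fun setT mu,
            forall x, (0 <= mu x)%R,
            forall B, measurable B ->
              marginal P B = \int[lebesgue_rV]_(x in B) (mu x)%:E &
            forall x, A x -> (mu x <= mumax)%R]].

(* Membership of P in the class P'_Sigma. A conditional probability is only
   defined up to a P_X-null set, so the version eta is made explicit. *)
Definition PSigma' (alpha c0 r0 C0 beta L mumax : R) (K : set 'rV[R]_d) P eta :=
  [/\ regression P eta, margin alpha C0 P eta, holder beta L eta &
      mild_density c0 r0 mumax K P].

(* If P is in the class and P_X is supported on A, then
   1 = P_X(A) <= mumax * lebesgue_rV A. In the case of equality P_X is forced to
   be uniform on A: the density is then bounded away from zero on A and faster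
   rates are possible. The class is rich enough for the lower bound as soon as
   the inequality is strict for some A. *)
Definition rich_class (c0 r0 mumax : R) (K : set 'rV[R]_d) :=
  exists A : set 'rV[R]_d,
    [/\ compact A, A `<=` K, regular c0 r0 A & 1 < mumax%:E * lebesgue_rV A].

Definition risk P (g : 'rV[R]_d -> bool) : \bar R :=
  P [set z | z.2 != g z.1].

Definition bayes eta (x : 'rV[R]_d) : bool := (1 / 2 <= eta x)%R.

(* Joint measurability makes each f s Borel and the risk of f s a measurable
   function of the sample s. *)
Definition classifier n (f : n.-tuple Z -> 'rV[R]_d -> bool) :=
  measurable_fun setT (fun p : n.-tuple Z * 'rV[R]_d => f p.1 p.2).

Definition excess_risk n (f : n.-tuple Z -> 'rV[R]_d -> bool) P eta : \bar R :=
  (\int[mpower P n]_s risk P (f s)) - risk P (bayes eta).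

End classification.

(* Main.v *)
From HB Require Import structures.
Require Import Defs.
From mathcomp Require Import all_boot all_order all_algebra.
From mathcomp Require Import all_classical all_reals all_analysis.
From mathcomp Require Import measurable_realfun ring lra zify.

(** The lower bound is obtained from a finite family of laws in the class, so
    close to one another that [n] observations cannot tell them apart.

    The family.  Let [A] be a regular compact set with
    [1 < mumax * lambda(A)].  Fix a small box [G] around a point of [A] and a
    scale [h].  Inside [G] lie disjoint cubes of half-side [h], centred at
    points of [A]; the core of a cube is the part of [A] at distance at most
    [h / 2] from its centre.  Regularity of [A] enters twice: it forces the
    number of such cubes to be of order [h ^- d], and it bounds the volume of
    each core from below by a multiple of [h ^+ d], so the total volume of the
    cores does not depend on [h] up to a constant ([packing]).  The marginal
    law has the small density [tau], of order [h `^ (alpha * beta)], on the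
    cores, and its remaining mass is spread over [A] outside [G]; the strict
    inequality [1 < mumax * lambda(A)] makes room for that mass once [G] is
    small ([exists_design]).  The regression function equals [1 / 2] plus, on
    each cube, a bump of height of order [b], with a sign chosen freely on each
    cube.  With [b] of order [h `^ beta] the result is in the Hoelder class
    ([holder_bumps]).  The margin condition holds because the mass of the
    points where the regression function differs from [1 / 2] is at most
    [tau], while the gap on the cores, which carry this mass, is at least of
    order [h `^ beta] ([margin_signed]).

    The bound.  The excess risk is the integral over [x] of
    [`|2 * eta x - 1|] times the probability that the classifier errs at [x]
    ([excess_risk_label]).  Sum it over all choices of signs and, for [x] in
    the cube [j], pair the choices that differ at [j] only.  The two laws of a
    pair differ on an event of probability of order [tau * h ^+ d], and there
    by the factor [1 + b] against [1 - b], so their squared Hellinger distance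
    is of order [tau * h ^+ d * b ^+ 2].  When [n] times this quantity is below
    a constant, the two error probabilities add up to at least [1 / 8]
    ([two_point_testing], [flip_error]).  Hence some choice of signs has an
    excess risk of order [tau * b], which is [h `^ ((1 + alpha) * beta)]
    ([assouad]).  The constraint on [n] allows [h] of order
    [n `^ (- 1 / ((2 + alpha) * beta + d))], which gives the rate. *)

Set Implicit Arguments.
Unset Strict Implicit.
Unset Printing Implicit Defensive.

Import Order.TTheory GRing.Theory Num.Theory.
Import numFieldNormedType.Exports.

Local Open Scope classical_set_scope.
Local Open Scope ring_scope.

(** * Measures with a density *)

Section density.
Local Open Scope ereal_scope.
Context d (T : measurableType d) (R : realType).
Variable mu : {measure set T -> \bar R}.
Variable p : T -> R.
Hypotheses (mp : measurable_fun setT p) (p0 : forall x, (0 <= p x)%R).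

(** The hypotheses on the density are arguments, so that the measure structure
    below is attached to the set function itself. *)
Definition with_density of measurable_fun setT p & (forall x, (0 <= p x)%R) :=
  fun A : set T => \int[mu]_(x in A) (p x)%:E.

Local Notation nu := (with_density mp p0).

Let density0 : nu set0 = 0.
Proof. exact: integral_set0. Qed.

Let density_ge0 A : 0 <= nu A.
Proof. by apply: integral_ge0 => x _; rewrite lee_fin. Qed.

Let density_sigma_additive : semi_sigma_additive nu.
Proof.
move=> F mF tF mUF; rewrite /with_density ge0_integral_bigcup//; last 2 first.
  exact/measurable_EFinP/measurable_funTS.
  by move=> x _; rewrite lee_fin.
apply: is_cvg_ereal_nneg_natsum_cond => n _ _.
by apply: integral_ge0 => x _; rewrite lee_fin.
Qed.

HB.instance Definition _ := isMeasure.Build _ _ _ nu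
  density0 density_ge0 density_sigma_additive.

(** Measures with prescribed structure are obtained by existence statements, so
    that later lemmas speak of an arbitrary measure given by its values. *)
Lemma density_measure : exists nu : {measure set T -> \bar R},
  forall A, nu A = \int[mu]_(x in A) (p x)%:E.
Proof. by exists [the {measure set T -> \bar R} of nu]. Qed.

End density.

Section total_mass.
Local Open Scope ereal_scope.
Context d (T : measurableType d) (R : realType).
Variable nu : {measure set T -> \bar R}.

Definition finite_copy of nu setT < +oo := fun A : set T => nu A.

Section instances.
Hypothesis nuoo : nu setT < +oo.
Let m0 : finite_copy nuoo set0 = 0. Proof. exact: measure0. Qed.
Let m_ge0 A : 0 <= finite_copy nuoo A. Proof. exact: measure_ge0. Qed.
Let m_sigma_additive : semi_sigma_additive (finite_copy nuoo).
Proof. exact: measure_semi_sigma_additive. Qed.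
HB.instance Definition _ := isMeasure.Build _ _ _ (finite_copy nuoo)
  m0 m_ge0 m_sigma_additive.
Let m_fin : fin_num_fun (finite_copy nuoo).
Proof. exact: lty_fin_num_fun. Qed.
HB.instance Definition _ := Measure_isFinite.Build _ _ _ (finite_copy nuoo) m_fin.
End instances.

Lemma finite_of_measure : nu setT < +oo ->
  exists m : {finite_measure set T -> \bar R}, forall A, m A = nu A.
Proof. by move=> h; exists (finite_copy h). Qed.

Definition probability_copy of nu setT = 1 := fun A : set T => nu A.

Section instances.
Hypothesis nu1 : nu setT = 1.
Let m0 : probability_copy nu1 set0 = 0. Proof. exact: measure0. Qed.
Let m_ge0 A : 0 <= probability_copy nu1 A. Proof. exact: measure_ge0. Qed.
Let m_sigma_additive : semi_sigma_additive (probability_copy nu1).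
Proof. exact: measure_semi_sigma_additive. Qed.
HB.instance Definition _ := isMeasure.Build _ _ _ (probability_copy nu1)
  m0 m_ge0 m_sigma_additive.
HB.instance Definition _ :=
  Measure_isProbability.Build _ _ _ (probability_copy nu1) nu1.
End instances.

Lemma probability_of_measure : nu setT = 1 ->
  exists P : probability T R, forall A, P A = nu A.
Proof. by move=> h; exists (probability_copy h). Qed.

End total_mass.

Section density_theory.
Local Open Scope ereal_scope.
Context d (T : measurableType d) (R : realType).

Import HBNNSimple.

(** Change of measure: true by definition for indicators, by linearity for
    simple functions, and by monotone convergence in general. *)
Lemma integral_density (mu nu : {measure set T -> \bar R}) (p : T -> R) :
  measurable_fun setT p -> (forall x, (0 <= p x)%R) ->
  (forall A, measurable A -> nu A = \int[mu]_(x in A) (p x)%:E) ->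
  forall f : T -> \bar R, measurable_fun setT f -> (forall x, 0 <= f x) ->
  \int[nu]_x f x = \int[mu]_x (f x * (p x)%:E).
Proof.
move=> mp p0 nuE f mf f0.
have mpE : measurable_fun setT (EFin \o p) by exact/measurable_EFinP.
have indicE' A : measurable A ->
    \int[nu]_x (\1_A x)%:E = \int[mu]_x ((\1_A x)%:E * (p x)%:E).
  move=> mA; rewrite integral_indic// setIT nuE// integral_mkcond.
  apply: eq_integral => x _; rewrite patchE indicE.
  by case: ifPn; rewrite ?mul1e ?mul0e.
have simpleE (g : {nnsfun T >-> R}) :
    \int[nu]_x (g x)%:E = \int[mu]_x ((g x)%:E * (p x)%:E).
  under eq_integral do rewrite fimfunE -fsumEFin//.
  rewrite ge0_integral_fsum//; last 2 first.
    - by move=> r; exact/measurable_EFinP/measurable_funM.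
    - by move=> r x _; exact: nnfun_muleindic_ge0.
  under [RHS]eq_integral.
    move=> x _; rewrite [in X in X * _]fimfunE -fsumEFin// ge0_mule_fsuml; last first.
      by move=> r; exact: nnfun_muleindic_ge0.
    over.
  rewrite ge0_integral_fsum//; last 2 first.
    - move=> r; apply: emeasurable_funM => //.
      exact/measurable_EFinP/measurable_funM.
    - by move=> r x _; apply: mule_ge0; [exact: nnfun_muleindic_ge0|rewrite lee_fin].
  apply: eq_fsbigr => r /[!inE] -[t _ <-].
  under eq_integral do rewrite EFinM.
  rewrite ge0_integralZl//; last by rewrite lee_fin.
  under [RHS]eq_integral do rewrite EFinM -muleA.
  rewrite indicE'// [RHS]ge0_integralZl//.
  - apply: emeasurable_funM => //; exact/measurable_EFinP.
  - by move=> x _; rewrite mule_ge0// lee_fin.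
  - by rewrite lee_fin.
  exact/measurable_EFinP.
pose gn := nnsfun_approx measurableT mf.
have gf x : EFin \o gn ^~ x @ \oo --> f x by exact: cvg_nnsfun_approx.
transitivity (limn (fun n => \int[nu]_x (gn n x)%:E)).
  rewrite -monotone_convergence//.
  - by apply: eq_integral => x _; apply/esym/cvg_lim => //; exact: gf.
  - by move=> n; exact/measurable_EFinP.
  - by move=> n x _; rewrite lee_fin.
  - by move=> x _ m n mn; rewrite lee_fin; exact/lefP/nd_nnsfun_approx.
rewrite (_ : (fun n => _) = (fun n => \int[mu]_x ((gn n x)%:E * (p x)%:E))); last first.
  by apply/funext => n; exact: simpleE.
rewrite -monotone_convergence//.
- apply: eq_integral => x _; apply/cvg_lim => //.
  by apply: cvgeZr => //; exact: gf.
- by move=> n; apply: emeasurable_funM => //; exact/measurable_EFinP.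
- by move=> n x _; rewrite mule_ge0// lee_fin.
- move=> x _ m n mn; rewrite lee_wpmul2r ?lee_fin//.
  exact/lefP/nd_nnsfun_approx.
Qed.

End density_theory.

(** * Product laws and the testing of two hypotheses *)

Section mpower_density.
Local Open Scope ereal_scope.
Context d (T : measurableType d) (R : realType).

Definition tuple_prod (p : T -> R) n (t : n.-tuple T) : R :=
  (\prod_(i < n) p (tnth t i))%R.

Lemma measurable_tuple_prod (p : T -> R) n :
  measurable_fun setT p -> measurable_fun setT (@tuple_prod p n).
Proof.
move=> mp; apply: measurable_prod => i _.
by apply: measurableT_comp => //; exact: measurable_tnth.
Qed.

Lemma tuple_prod_ge0 (p : T -> R) n (t : n.-tuple T) :
  (forall x, (0 <= p x)%R) -> (0 <= tuple_prod p t)%R.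
Proof. by move=> p0; exact: prodr_ge0. Qed.

Lemma tuple_prod_tcons (p : T -> R) n (z : T * n.-tuple T) :
  tuple_prod p (tcons z) = (p z.1 * tuple_prod p z.2)%R.
Proof.
rewrite /tuple_prod big_ord_recl; congr (_ * _)%R.
by apply: eq_bigr => i _; rewrite tnthS.
Qed.

(** The likelihood of a sample is the product of the likelihoods of the
    observations.  By induction on the size of the sample: the change of measure
    handles the first observation and Tonelli's theorem exchanges the two
    integrals.  Sigma-finite measures are allowed, so that the integral of a product
    function can be read as the mass of a power measure. *)
Lemma mpower_density (P Q : {sigma_finite_measure set T -> \bar R})
    (p : T -> R) :
  measurable_fun setT p -> (forall x, (0 <= p x)%R) ->
  (forall A, measurable A -> P A = \int[Q]_(x in A) (p x)%:E) ->
  forall n A, measurable A ->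
  mpower P n A = \int[mpower Q n]_(t in A) (tuple_prod p t)%:E.
Proof.
move=> mp p0 PE; elim=> [|n IH] A mA.
  under eq_integral do rewrite /tuple_prod big_ord0.
  by rewrite integral_cst// mul1e.
rewrite [LHS]/= /pushforward.
have mB : measurable (@tcons _ T n @^-1` A).
  by rewrite -[X in measurable X]setTI; exact: measurable_tcons.
pose F (z : T * n.-tuple T) : \bar R :=
  (\1_(@tcons _ T n @^-1` A) z * tuple_prod p z.2)%:E.
have mL : measurable_fun setT (fun z : T * n.-tuple T => tuple_prod p z.2).
  by apply: measurableT_comp => //; exact: measurable_tuple_prod.
have mF : measurable_fun setT F.
  exact/measurable_EFinP/measurable_funM.
have F0 z : 0 <= F z by rewrite lee_fin mulr_ge0// tuple_prod_ge0.
transitivity (\int[P]_x \int[mpower Q n]_t F (x, t)).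
  rewrite /product_measure1; apply: eq_integral => x _.
  rewrite /= IH; last exact: measurable_xsection.
  rewrite integral_mkcond; apply: eq_integral => t _.
  rewrite /F patchE mem_xsection indicE /=.
  by case: ifPn; rewrite ?mul1r ?mul0r.
rewrite (integral_density mp p0 PE)//; last 2 first.
  exact: (@measurable_fun_fubini_tonelli_F _ _ _ _ _ (mpower Q n)).
  by move=> x; apply: integral_ge0.
transitivity (\int[Q]_x \int[mpower Q n]_t ((p x)%:E * F (x, t))).
  apply: eq_integral => x _; rewrite muleC -ge0_integralZl ?lee_fin//.
  by apply: (measurableT_comp mF); exact: pair1_measurable.
transitivity (\int[Q \x mpower Q n]_z ((p z.1)%:E * F z)).
  rewrite fubini_tonelli1//.
    apply: emeasurable_funM => //; apply/measurable_EFinP.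
    by apply: measurableT_comp.
  by move=> z; rewrite mule_ge0// lee_fin.
transitivity (\int[Q \x mpower Q n]_(z in @tcons _ T n @^-1` A)
    (EFin \o tuple_prod p (n:=n.+1) \o @tcons _ T n) z).
  rewrite [RHS]integral_mkcond; apply: eq_integral => z _.
  rewrite patchE /F indicE /= tuple_prod_tcons.
  by case: ifPn; rewrite ?mul1r ?mul0r ?mule0// EFinM.
rewrite -ge0_integral_pushforward//.
- exact: measurable_tcons.
- apply: measurable_funTS; apply/measurable_EFinP; exact: measurable_tuple_prod.
- by move=> t _; rewrite lee_fin tuple_prod_ge0.
Qed.

(** The form [2 * c <= t * a + (a + b) / t] of the inequality between arithmetic
    and geometric means, for [t = 4]; it replaces the Cauchy-Schwarz inequality
    in Le Cam's bound. *)
Lemma double_le_amgm (a b c : R) : (0 <= a)%R -> (0 <= b)%R -> (0 <= c)%R ->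
  (c ^+ 2 <= a * b)%R -> (2 * c <= 4 * a + 4^-1 * (a + b))%R.
Proof.
move=> a0 b0 c0 cab.
apply: (@le_trans _ _ (4 * a + 4^-1 * b)%R); last by lra.
rewrite -(@ler_pXn2r _ 2)// ?nnegrE; [|lra|lra].
have : (0 <= (4 * a - 4^-1 * b) ^+ 2)%R by exact: sqr_ge0.
move: cab; rewrite !expr2; lra.
Qed.

Lemma ge0_integral_lin d' (T' : measurableType d') (mu : {measure set T' -> \bar R})
    (c k : R) (u v : T' -> R) : (0 <= c)%R -> (0 <= k)%R ->
  measurable_fun setT u -> measurable_fun setT v ->
  (forall t, (0 <= u t)%R) -> (forall t, (0 <= v t)%R) ->
  \int[mu]_t (c * u t + k * v t)%:E =
  c%:E * \int[mu]_t (u t)%:E + k%:E * \int[mu]_t (v t)%:E.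
Proof.
move=> c0 k0 mu' mv u0 v0.
under eq_integral do rewrite EFinD !EFinM.
have mu1 := (measurable_EFinP _ _).2 mu'.
have mv1 := (measurable_EFinP _ _).2 mv.
rewrite ge0_integralD//=.
- by rewrite !ge0_integralZl// => t _; rewrite lee_fin.
- by move=> t _; rewrite -EFinM lee_fin mulr_ge0.
- exact: measurable_funeM.
- by move=> t _; rewrite -EFinM lee_fin mulr_ge0.
- exact: measurable_funeM.
Qed.

(** Le Cam's two-point bound.  The affinity of [P] and [P'] is the integral of
    the geometric mean of their densities; [r] is any lower bound of that mean,
    and the affinity of the product laws is at least the [n]-th power of the
    integral of [r].  With [L], [L'] and [Rn] the products along the sample of
    [p], [p'] and [r], one has [Rn ^+ 2 <= L * L'], and [double_le_amgm] bounds
    [2 * Rn] by four times the error density plus [(L + L') / 4].  After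
    integration, [2 / 2 <= 4 * (sum of the errors) + 2 / 4]. *)
Lemma two_point_testing (Q P P' : probability T R) (p p' r : T -> R) (n : nat) :
  measurable_fun setT p -> measurable_fun setT p' -> measurable_fun setT r ->
  (forall x, (0 <= p x)%R) -> (forall x, (0 <= p' x)%R) ->
  (forall x, (0 <= r x)%R) -> (forall x, (r x ^+ 2 <= p x * p' x)%R) ->
  (forall A, measurable A -> P A = \int[Q]_(x in A) (p x)%:E) ->
  (forall A, measurable A -> P' A = \int[Q]_(x in A) (p' x)%:E) ->
  (2^-1)%:E <= (\int[Q]_x (r x)%:E) ^+ n ->
  forall E, measurable E -> (8^-1)%:E <= mpower P n (~` E) + mpower P' n E.
Proof.
move=> mp mp' mr p0 p'0 r0 rpp' PE P'E rn E mE.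
pose L (t : n.-tuple T) := tuple_prod p t.
pose L' (t : n.-tuple T) := tuple_prod p' t.
pose Rn (t : n.-tuple T) := tuple_prod r t.
have mL : measurable_fun setT L by exact: measurable_tuple_prod.
have mL' : measurable_fun setT L' by exact: measurable_tuple_prod.
have mRn : measurable_fun setT Rn by exact: measurable_tuple_prod.
have L0 t : (0 <= L t)%R by exact: tuple_prod_ge0.
have L'0 t : (0 <= L' t)%R by exact: tuple_prod_ge0.
have R0 t : (0 <= Rn t)%R by exact: tuple_prod_ge0.
have RLL' t : (Rn t ^+ 2 <= L t * L' t)%R.
  rewrite /Rn /L /L' /tuple_prod -prodrXl -big_split/=.
  by apply: ler_prod => i _; rewrite sqr_ge0 rpp'.
pose a := fun t => (4 * (\1_(~` E) t * L t + \1_E t * L' t) + 4^-1 * (L t + L' t))%R.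
have key t : (2 * Rn t <= a t)%R.
  have h := RLL' t; have h1 := L0 t; have h2 := L'0 t; have h3 := R0 t.
  rewrite /a !indicE in_setC; case: (t \in E) => /=.
    rewrite mul0r mul1r add0r (addrC (L t)).
    by apply: double_le_amgm => //; rewrite mulrC.
  by rewrite mul0r mul1r addr0; exact: double_le_amgm.
(* The integral of [Rn] is the total mass of the [n]-th power of the measure
   with density [r], that is, the [n]-th power of its mass. *)
have intR : (2^-1)%:E <= \int[mpower Q n]_t (Rn t)%:E.
  have Roo : \int[Q]_x (r x)%:E < +oo.
    apply: (@le_lt_trans _ _ (\int[Q]_x ((p x)%:E + (p' x)%:E))).
      apply: ge0_le_integral => //=.
      - by move=> x _; rewrite lee_fin.
      - exact/measurable_EFinP.
      - by apply: emeasurable_funD; exact/measurable_EFinP.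
      - move=> x _; rewrite -EFinD lee_fin.
        have := rpp' x; have := p0 x; have := p'0 x; have := r0 x; nra.
    rewrite ge0_integralD//=; last 4 first.
      by move=> x _; rewrite lee_fin.
      exact/measurable_EFinP.
      by move=> x _; rewrite lee_fin.
      exact/measurable_EFinP.
    by rewrite -PE// -P'E// !probability_setT ltry.
  have [m mE'] := density_measure Q mr r0.
  have moo : m setT < +oo by rewrite mE'.
  have [m' m'E] := finite_of_measure moo.
  have <- := @mpower_density m' Q r mr r0
    (fun A _ => etrans (m'E A) (mE' A)) n _ measurableT.
  have /= := @mpower_box _ _ _ m' n (fun=> setT) (fun=> measurableT).
  rewrite (_ : [set t | _] = setT); last by apply/seteqP; split.
  move=> ->; rewrite (eq_bigr (fun=> \int[Q]_x (r x)%:E)); last first.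
    by move=> i _; rewrite m'E mE'.
  rewrite (le_trans rn)//; move: (\int[Q]_x _) => y.
  suff -> : \prod_(i < n) y = y ^+ n by [].
  by elim: (n) => [|k IH]; rewrite ?big_ord0// big_ord_recl IH expeS.
have PnE (A : set (n.-tuple T)) : measurable A ->
    mpower P n A = \int[mpower Q n]_t (\1_A t * L t)%:E.
  move=> mA; rewrite (mpower_density mp p0 PE)// integral_mkcond.
  apply: eq_integral => t _; rewrite patchE indicE.
  by case: ifPn; rewrite ?mul1r ?mul0r.
have P'nE (A : set (n.-tuple T)) : measurable A ->
    mpower P' n A = \int[mpower Q n]_t (\1_A t * L' t)%:E.
  move=> mA; rewrite (mpower_density mp' p'0 P'E)// integral_mkcond.
  apply: eq_integral => t _; rewrite patchE indicE.
  by case: ifPn; rewrite ?mul1r ?mul0r.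
have : \int[mpower Q n]_t (2 * Rn t)%:E <= \int[mpower Q n]_t (a t)%:E.
  apply: ge0_le_integral => //=.
  - by move=> t _; rewrite lee_fin mulr_ge0.
  - exact/measurable_EFinP/measurable_funM.
  - apply/measurable_EFinP; rewrite /a.
    by repeat (apply: measurable_funD || apply: measurable_funM) => //;
      apply: measurable_indic; exact: measurableC.
  - by move=> t _; rewrite lee_fin.
have -> : \int[mpower Q n]_t (2 * Rn t)%:E = 2%:E * \int[mpower Q n]_t (Rn t)%:E.
  under eq_integral do rewrite EFinM.
  by rewrite ge0_integralZl//; [exact/measurable_EFinP|move=> t _; rewrite lee_fin].
have -> : \int[mpower Q n]_t (a t)%:E =
    4%:E * (mpower P n (~` E) + mpower P' n E) + (4^-1)%:E * (1 + 1).
  rewrite PnE ?P'nE//; last exact: measurableC.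
  have intL : \int[mpower Q n]_t (L t)%:E = 1.
    transitivity (mpower P n setT); last first.
      exact: (probability_setT (mpower P n : probability _ R)).
    rewrite PnE//.
    by apply: eq_integral => t _; rewrite indicT mul1r.
  have intL' : \int[mpower Q n]_t (L' t)%:E = 1.
    transitivity (mpower P' n setT); last first.
      exact: (probability_setT (mpower P' n : probability _ R)).
    rewrite P'nE//.
    by apply: eq_integral => t _; rewrite indicT mul1r.
  have m1 : measurable_fun setT (fun t => (\1_(~` E) t * L t)%R).
    by apply: measurable_funM => //; apply: measurable_indic; exact: measurableC.
  have m2 : measurable_fun setT (fun t => (\1_E t * L' t)%R).
    exact: measurable_funM.
  have n1 t : (0 <= \1_(~` E) t * L t)%R by rewrite mulr_ge0.
  have n2 t : (0 <= \1_E t * L' t)%R by rewrite mulr_ge0.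
  rewrite (@ge0_integral_lin _ _ (mpower Q n) 4 4^-1
    (fun t => \1_(~` E) t * L t + \1_E t * L' t)%R (fun t => L t + L' t)%R)//;
    last 4 first.
  - exact: measurable_funD.
  - exact: measurable_funD.
  - by move=> t; rewrite addr_ge0.
  - by move=> t; rewrite addr_ge0.
  congr (_ * _ + _ * _).
    transitivity (\int[mpower Q n]_t (1 * (\1_(~` E) t * L t) + 1 * (\1_E t * L' t))%:E).
      by apply: eq_integral => t _; rewrite !mul1r.
    by rewrite ge0_integral_lin// !mul1e.
  transitivity (\int[mpower Q n]_t (1 * L t + 1 * L' t)%:E).
    by apply: eq_integral => t _; rewrite !mul1r.
  by rewrite ge0_integral_lin// !mul1e intL intL'.
set S := (_ + _ : \bar R); set I := integral _ _ _ => h.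
have S0 : 0 <= S by rewrite adde_ge0.
have [Soo|] := ltP S +oo; last by rewrite leye_eq => /eqP ->; rewrite leey.
have Sf : S \is a fin_num by rewrite ge0_fin_numE.
have I2 : 2%:E * (2^-1)%:E <= 2%:E * I by rewrite lee_pmul2l.
have := le_trans I2 h.
rewrite -(fineK Sf) (_ : 1 + 1 = 2%:E)// -!EFinM -EFinD !lee_fin; lra.
Qed.

End mpower_density.

(** * Binary labels over a fixed marginal law *)

Lemma measurable_neq_bool d (T : measurableType d) (f g : T -> bool) :
  measurable_fun setT f -> measurable_fun setT g ->
  measurable [set t | f t != g t].
Proof.
move=> mf mg.
rewrite (_ : [set t | _] = (f @^-1` [set true] `&` g @^-1` [set false]) `|`
                            (f @^-1` [set false] `&` g @^-1` [set true])).
  by apply: measurableU; apply: measurableI;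
    rewrite -[X in measurable X]setTI; (exact: mf || exact: mg).
apply/seteqP; split => t /=.
  by case: (f t) (g t) => -[]//= _; [left|right].
by case=> -[-> ->].
Qed.

Section labels.
Local Open Scope ereal_scope.
Context (R : realType) (d : nat).
Local Notation X := 'rV[R]_d.
Local Notation Z := ('rV[R]_d * bool)%type.

Definition label_sign (y : bool) : R := (if y then 1 else -1)%R.

Definition fair_coin : probability bool R := bernoulli_prob (2^-1 : R).

Lemma label_signN y : label_sign (~~ y) = (- label_sign y)%R.
Proof. by case: y; rewrite /label_sign/= ?opprK. Qed.

Lemma measurable_label_sign : measurable_fun setT label_sign.
Proof. by []. Qed.

Variable PX : probability X R.
Local Notation Q := (PX \x fair_coin).

(** The reference law [PX \x fair_coin] has labels independent of [X]; all the
    laws of the family have a density with respect to it. *)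
Lemma integral_fair_coin (f : Z -> \bar R) :
  measurable_fun setT f -> (forall z, 0 <= f z) ->
  \int[Q]_z f z = \int[PX]_x ((2^-1)%:E * f (x, true) + (2^-1)%:E * f (x, false)).
Proof.
move=> mf f0; rewrite fubini_tonelli1//; apply: eq_integral => x _.
rewrite /fubini_F integral_bernoulli_prob//; last by apply/andP; split; lra.
by rewrite (_ : unstable.onem 2^-1 = 2^-1 :> R)%R//; rewrite /unstable.onem; lra.
Qed.

(** The density that turns the fair labels into labels with regression function
    [(1 + phi) / 2]. *)
Definition label_density (phi : X -> R) (z : Z) : R := (1 + label_sign z.2 * phi z.1)%R.

Lemma measurable_label_density phi :
  measurable_fun setT phi -> measurable_fun setT (label_density phi).
Proof.
move=> mphi; apply: measurable_funD => //; apply: measurable_funM.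
  exact: (measurableT_comp measurable_label_sign).
exact: measurableT_comp.
Qed.

Lemma label_density_ge0 phi :
  (forall x, `|phi x| <= 1)%R -> forall z, (0 <= label_density phi z)%R.
Proof.
move=> phi1 [x y]; rewrite /label_density/=.
by have := phi1 x; rewrite ler_norml => /andP[? ?]; case: y; rewrite /label_sign; lra.
Qed.

Section law.
Variable phi : X -> R.
Hypotheses (mphi : measurable_fun setT phi) (phi1 : forall x, (`|phi x| <= 1)%R).

Let mld := measurable_label_density mphi.
Let ld0 := label_density_ge0 phi1.

Lemma label_law : exists P : probability Z R,
  forall A, measurable A -> P A = \int[Q]_(z in A) (label_density phi z)%:E.
Proof.
have [nu nuE] := density_measure Q mld ld0.
have nu1 : nu setT = 1.
  rewrite nuE integral_fair_coin//; last exact/measurable_EFinP.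
    transitivity (\int[PX]_x cst 1%E x); last first.
      by rewrite integral_cst// mul1e; exact: probability_setT.
    apply: eq_integral => x _; rewrite -!EFinM -EFinD; congr _%:E.
    by rewrite /label_density/= /label_sign; lra.
have [P PE] := probability_of_measure nu1.
by exists P => A _; rewrite PE nuE.
Qed.

Variable P : probability Z R.
Hypothesis PE : forall A, measurable A ->
  P A = \int[Q]_(z in A) (label_density phi z)%:E.

Lemma integral_label (f : Z -> \bar R) :
  measurable_fun setT f -> (forall z, 0 <= f z) ->
  \int[P]_z f z = \int[PX]_x (((1 + phi x) / 2)%:E * f (x, true)
                            + ((1 - phi x) / 2)%:E * f (x, false)).
Proof.
move=> mf f0; rewrite (integral_density mld ld0 PE)// integral_fair_coin; last 2 first.
- by apply: emeasurable_funM => //; exact/measurable_EFinP.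
- by move=> z; rewrite mule_ge0// lee_fin.
apply: eq_integral => x _.
rewrite !(muleC (f _)) !muleA -!EFinM /label_density/= /label_sign mul1r mulN1r.
by rewrite !(mulrC 2^-1%R).
Qed.

Lemma label_lawE A : measurable A ->
  P A = \int[PX]_x (((1 + phi x) / 2 * \1_A (x, true))%:E
                  + ((1 - phi x) / 2 * \1_A (x, false))%:E).
Proof.
move=> mA; rewrite -[in LHS](setIT A) -integral_indic// integral_label//.
exact/measurable_EFinP.
Qed.

Lemma marginal_label B : measurable B -> marginal P B = PX B.
Proof.
move=> mB; rewrite /marginal /pushforward label_lawE; last first.
  by rewrite -[X in measurable X]setTI; exact: measurable_fst.
rewrite -[in RHS](setIT B) -integral_indic//; apply: eq_integral => x _.
rewrite -EFinD; congr _%:E; rewrite !indicE.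
have E y : ((x, y) \in (fst : Z -> X) @^-1` B) = (x \in B).
  by apply/idP/idP; rewrite !inE.
by rewrite !E; case: (x \in B) => /=; rewrite ?mulr0 ?addr0 ?mulr1//; lra.
Qed.

Lemma integral_marginal_label (f : X -> \bar R) B : measurable B ->
  \int[marginal P]_(x in B) f x = \int[PX]_(x in B) f x.
Proof.
move=> mB; apply: eq_measure_integral => A mA _; exact: marginal_label.
Qed.

Definition eta_of (x : X) : R := ((1 + phi x) / 2)%R.

Lemma regression_label : regression P eta_of.
Proof.
split.
- by apply: measurable_funM => //; exact: measurable_funD.
- move=> x; have := phi1 x; rewrite ler_norml => /andP[? ?].
  by rewrite /eta_of; apply/andP; split; lra.
move=> B mB; rewrite integral_marginal_label// integral_mkcond.
rewrite label_lawE; last exact: measurableX.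
apply: eq_integral => x _; rewrite patchE !indicE.
have -> : ((x, true) \in B `*` [set true]) = (x \in B).
  by apply/idP/idP; rewrite !inE /= => // -[].
have -> : ((x, false) \in B `*` [set true]) = false.
  by apply/negP; rewrite inE => -[].
by rewrite mulr0 adde0; case: ifPn; rewrite ?mulr1 ?mulr0.
Qed.

Lemma risk_label (g : X -> bool) : measurable_fun setT g ->
  risk P g = \int[PX]_x ((1 - label_sign (g x) * phi x) / 2)%:E.
Proof.
move=> mg; rewrite /risk label_lawE; last first.
  apply: measurable_neq_bool => //; exact: measurableT_comp.
apply: eq_integral => x _; rewrite -EFinD; congr _%:E; rewrite !indicE.
have E y : ((x, y) \in [set z : Z | z.2 != g z.1]) = (y != g x).
  by apply/idP/idP; rewrite inE.
rewrite !E.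
by case: (g x); rewrite /label_sign/= ?mulr0 ?mulr1; lra.
Qed.

Lemma bayes_eta_of x : bayes eta_of x = (0 <= phi x)%R.
Proof. by rewrite /bayes /eta_of; apply/idP/idP => h; lra. Qed.

End law.
End labels.

(** * Excess risk and the hypercube of sign choices *)

Section excess.
Local Open Scope ereal_scope.
Context (R : realType) (d : nat).
Local Notation X := 'rV[R]_d.
Local Notation Z := ('rV[R]_d * bool)%type.

Lemma measurable_sign (phi : X -> R) : measurable_fun setT phi ->
  measurable_fun setT (fun x => 0 <= phi x)%R.
Proof. by move=> mphi; apply: measurable_fun_ler. Qed.

Lemma classifier_section n (f : n.-tuple Z -> X -> bool) s :
  classifier f -> measurable_fun setT (f s).
Proof.
move=> cf.
apply: (@measurableT_comp _ _ _ _ _ _ (fun p : n.-tuple Z * X => f p.1 p.2) _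
  (fun x => (s, x))); first exact: cf.
exact: pair1_measurable.
Qed.

Lemma measurable_error (phi : X -> R) (P : probability Z R) n
    (f : n.-tuple Z -> X -> bool) :
  measurable_fun setT phi -> classifier f ->
  measurable_fun setT (fun x => mpower P n [set s | f s x != (0 <= phi x)%R]).
Proof.
move=> mphi cf.
pose D : set (n.-tuple Z * X) := [set p | f p.1 p.2 != (0 <= phi p.2)%R].
have mD : measurable D.
  apply: measurable_neq_bool => //.
  exact: (measurableT_comp (measurable_sign mphi) measurable_snd).
have := measurable_fun_ysection (mpower P n) mD.
congr measurable_fun; apply/funext => x /=; congr mpower.
by apply/seteqP; split => s; rewrite /ysection/= inE.
Qed.

(** Given [X = x], the Bayes rule errs with probability [(1 - `|phi x|) / 2], and
    a classifier that disagrees with it pays [`|phi x|] more.  Tonelli's theorem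
    then moves the expectation over the sample inside. *)
Lemma excess_risk_label (PX : probability X R) (phi : X -> R)
    (P : probability Z R) n (f : n.-tuple Z -> X -> bool) :
  measurable_fun setT phi -> (forall x, (`|phi x| <= 1)%R) ->
  (forall A, measurable A ->
     P A = \int[PX \x fair_coin R]_(z in A) (label_density phi z)%:E) ->
  classifier f ->
  excess_risk f P (eta_of phi) =
  \int[PX]_x (`|phi x|%:E * mpower P n [set s | f s x != (0 <= phi x)%R]).
Proof.
move=> mphi phi1 PE cf; rewrite /excess_risk.
set rb := risk P _.
have mb : measurable_fun setT (bayes (eta_of phi)).
  rewrite (_ : bayes _ = (fun x => 0 <= phi x)%R); first exact: measurable_sign.
  by apply/funext => x; exact: bayes_eta_of.
have rbE : rb = \int[PX]_x ((1 - `|phi x|) / 2)%:E.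
  rewrite /rb (risk_label mphi phi1 PE)//; apply: eq_integral => x _.
  congr (((1 - _) / 2)%:E); rewrite bayes_eta_of /label_sign.
  by case: ger0P => _; rewrite ?mul1r ?mulN1r.
pose D : set (n.-tuple Z * X) := [set p | f p.1 p.2 != (0 <= phi p.2)%R].
have mD : measurable D.
  apply: measurable_neq_bool => //.
  exact: (measurableT_comp (measurable_sign mphi) measurable_snd).
pose G (p : n.-tuple Z * X) := (`|phi p.2| * \1_D p)%:E.
have mG : measurable_fun setT G.
  apply/measurable_EFinP; apply: measurable_funM => //.
  by apply: measurableT_comp => //; exact: measurableT_comp.
have G0 p : 0 <= G p by rewrite lee_fin mulr_ge0.
have riskE s : risk P (f s) = rb + \int[PX]_x G (s, x).
  rewrite (risk_label mphi phi1 PE)//; last exact: classifier_section.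
  rewrite rbE -ge0_integralD//=; last 3 first.
  - by move=> x _; rewrite lee_fin; have := phi1 x; lra.
  - apply/measurable_EFinP; apply: measurable_funM => //.
    by apply: measurable_funB => //; exact: measurableT_comp.
  - by apply: (measurableT_comp mG); exact: pair1_measurable.
  apply: eq_integral => x _; rewrite -EFinD; congr _%:E.
  have -> : \1_D (s, x) = (f s x != (0 <= phi x)%R)%:R :> R.
    by rewrite indicE; congr ((nat_of_bool _)%:R); apply/idP/idP; rewrite inE.
  by case: (f s x); case: ger0P => h; rewrite /label_sign /=; lra.
under eq_integral do rewrite riskE.
have rbfin : rb \is a fin_num.
  apply: fin_num_measure; apply: measurable_neq_bool => //.
  exact: measurableT_comp.
have rb0 : 0 <= rb by exact: measure_ge0.
rewrite ge0_integralD//=; last 2 first.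
- by move=> s _; apply: integral_ge0.
- exact: (@measurable_fun_fubini_tonelli_F _ _ _ _ _ PX).
rewrite integral_cst// [X in _ * X](_ : _ = 1); last first.
  exact: (probability_setT (mpower P n : probability _ R)).
rewrite -/(risk _ _) -/rb mule1 (addeC rb) addeK//.
rewrite (@fubini_tonelli _ _ _ _ _ (mpower P n) PX G)//.
apply: eq_integral => x _.
have mDx : measurable [set s | f s x != (0 <= phi x)%R].
  apply: measurable_neq_bool => //.
  apply: (@measurableT_comp _ _ _ _ _ _ (fun p : n.-tuple Z * X => f p.1 p.2) _
    (fun s => (s, x))); first exact: cf.
  exact: pair2_measurable.
transitivity (\int[mpower P n]_s
    (`|phi x|%:E * (\1_[set s | f s x != (0 <= phi x)%R] s)%:E)).
  by apply: eq_integral => s _; rewrite -EFinM; congr ((_ * _)%:E).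
rewrite ge0_integralZl// ?lee_fin//; first by rewrite integral_indic// setIT.
exact/measurable_EFinP.
Qed.

(** A family indexed by sign vectors: the functions [w j] have disjoint supports,
    and [signed s] carries the sign [s j] on the support of [w j]. *)
Section hypercube.
Variables (PX : probability X R) (m : nat) (w : 'I_m -> X -> R).
Hypothesis mw : forall j, measurable_fun setT (w j).
Hypothesis w01 : forall j x, (0 <= w j x <= 1)%R.
Hypothesis wdisj : forall j k x, w j x != 0%R -> w k x != 0%R -> j = k.

Definition signed (s : {ffun 'I_m -> bool}) (x : X) : R :=
  (\sum_j label_sign R (s j) * w j x)%R.

Lemma signedE s x j : w j x != 0%R -> signed s x = (label_sign R (s j) * w j x)%R.
Proof.
move=> wj; rewrite /signed (bigD1 j)//= big1 ?addr0// => k kj.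
have [->|wk] := eqVneq (w k x) 0%R; first by rewrite mulr0.
by move: kj; rewrite (wdisj wj wk) eqxx.
Qed.

Lemma total_weightE x j : w j x != 0%R -> (\sum_k w k x = w j x)%R.
Proof.
move=> wj; rewrite (bigD1 j)//= big1 ?addr0// => k kj.
have [//|wk] := eqVneq (w k x) 0%R.
by move: kj; rewrite (wdisj wj wk) eqxx.
Qed.

Lemma weight_cases x : (exists j, w j x != 0%R) \/ (forall j, w j x = 0%R).
Proof.
have [/existsP[j wj]|/existsPn h] := boolP [exists j, w j x != 0%R].
  by left; exists j.
by right=> j; have := h j; rewrite negbK => /eqP.
Qed.

Lemma norm_signed s x : (`|signed s x| = \sum_j w j x)%R.
Proof.
have [[j wj]|w0] := weight_cases x.
  have /andP[wj0 _] := w01 j x.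
  rewrite (signedE s wj) (total_weightE wj) normrM (ger0_norm wj0).
  by case: (s j); rewrite /label_sign ?normrN normr1 mul1r.
by rewrite /signed !big1 ?normr0// => j _; rewrite w0 ?mulr0.
Qed.

Lemma signed_le1 s x : (`|signed s x| <= 1)%R.
Proof.
rewrite norm_signed; have [[j wj]|w0] := weight_cases x.
  by rewrite (total_weightE wj); case/andP: (w01 j x).
by rewrite big1.
Qed.

Lemma measurable_signed s : measurable_fun setT (signed s).
Proof. by apply: measurable_sum => j; apply: measurable_funM. Qed.

Definition flip (j : 'I_m) (s : {ffun 'I_m -> bool}) : {ffun 'I_m -> bool} :=
  [ffun k => if k == j then ~~ s k else s k].

Lemma flipK j : involutive (flip j).
Proof.
by move=> s; apply/ffunP => k; rewrite !ffunE; case: eqP => // _; rewrite negbK.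
Qed.

Lemma sign_signed s x j : w j x != 0%R -> (0 <= signed s x)%R = s j.
Proof.
move=> wj; rewrite (signedE s wj).
have wp : (0 < w j x)%R by rewrite lt_neqAle eq_sym wj; case/andP: (w01 j x).
case: (s j); rewrite /label_sign ?mul1r ?mulN1r; first exact: ltW.
by apply/negbTE; rewrite oppr_ge0 -ltNge.
Qed.

(** A lower bound for the geometric mean of the densities of two laws that differ
    by the sign at [j]: off the support of [w j] it is their common value, and on
    this support it is [1 - w j ^+ 2], while the two densities are [1 + w j] and
    [1 - w j].  A polynomial formula makes measurability and integration
    immediate. *)
Definition common_density (j : 'I_m) (s : {ffun 'I_m -> bool}) (z : Z) : R :=
  (1 + label_sign R z.2 * signed s z.1
   - label_sign R z.2 * label_sign R (s j) * w j z.1 - w j z.1 ^+ 2)%R.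

Lemma common_density_on j s z : w j z.1 != 0%R ->
  common_density j s z = (1 - w j z.1 ^+ 2)%R.
Proof. by move=> wj; rewrite /common_density (signedE s wj) mulrA addrK. Qed.

Lemma common_density_off j s z : w j z.1 = 0%R ->
  common_density j s z = label_density (signed s) z.
Proof. by move=> wj; rewrite /common_density wj expr0n/= mulr0 !subr0. Qed.

Lemma common_density_ge0 j s z : (0 <= common_density j s z)%R.
Proof.
have [wj|wj] := eqVneq (w j z.1) 0%R.
  by rewrite common_density_off//; apply: label_density_ge0 => x; exact: signed_le1.
have /andP[? ?] := w01 j z.1.
by rewrite common_density_on// subr_ge0 exprn_ile1.
Qed.

Lemma signed_flip_off j s x : w j x = 0%R -> signed (flip j s) x = signed s x.
Proof.
move=> wj; apply: eq_bigr => k _; rewrite ffunE.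
by case: eqP => // ->; rewrite wj !mulr0.
Qed.

Lemma common_density_sqr_le j s z :
  (common_density j s z ^+ 2 <=
   label_density (signed s) z * label_density (signed (flip j s)) z)%R.
Proof.
have [wj|wj] := eqVneq (w j z.1) 0%R.
  by rewrite common_density_off// /label_density signed_flip_off.
rewrite common_density_on// /label_density !(signedE _ wj) ffunE eqxx label_signN.
have /andP[h0 h1] := w01 j z.1.
set u := w j z.1 in h0 h1 *.
suff : ((1 - u ^+ 2) ^+ 2 <= 1 - u ^+ 2)%R.
  by case: (z.2); case: (s j); rewrite /label_sign; lra.
by rewrite expr2 ler_piMl ?subr_ge0 ?exprn_ile1// gerBl sqr_ge0.
Qed.

Lemma measurable_common_density j s : measurable_fun setT (common_density j s).
Proof.
have m1 : measurable_fun setT (fun z : Z => w j z.1) by exact: measurableT_comp.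
have m2 : measurable_fun setT (fun z : Z => label_sign R z.2).
  exact: (measurableT_comp (@measurable_label_sign R)).
apply: measurable_funB; last exact: measurable_funX.
apply: measurable_funB; last first.
  by apply: measurable_funM => //; exact: measurable_funM.
exact: (measurable_label_density (measurable_signed s)).
Qed.

(** Stated as a sum, so that no subtraction of extended reals occurs. *)
Lemma integral_common_density j s :
  \int[PX \x fair_coin R]_z (common_density j s z)%:E + \int[PX]_x (w j x ^+ 2)%:E = 1.
Proof.
rewrite integral_fair_coin; last 2 first.
- by apply/measurable_EFinP; exact: measurable_common_density.
- by move=> z; rewrite lee_fin common_density_ge0.
transitivity (\int[PX]_x (1 * (1 - w j x ^+ 2) + 1 * w j x ^+ 2)%:E).
  rewrite [RHS]ge0_integral_lin//; last 4 first.
  - by apply: measurable_funB => //; exact: measurable_funX.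
  - exact: measurable_funX.
  - by move=> x; rewrite subr_ge0; have /andP[? ?] := w01 j x; rewrite exprn_ile1.
  - by move=> x; rewrite sqr_ge0.
  rewrite !mul1e; congr (_ + _); apply: eq_integral => x _.
  by rewrite -!EFinM -EFinD; congr _%:E; rewrite /common_density/= /label_sign; lra.
transitivity (\int[PX]_x cst 1%E x).
  by apply: eq_integral => x _; congr _%:E; lra.
by rewrite integral_cst// mul1e; exact: probability_setT.
Qed.

End hypercube.

End excess.

Section assouad.
Local Open Scope ereal_scope.
Context (R : realType) (d : nat).
Local Notation X := 'rV[R]_d.
Local Notation Z := ('rV[R]_d * bool)%type.
Variables (PX : probability X R) (m : nat) (w : 'I_m -> X -> R).
Hypothesis mw : forall j, measurable_fun setT (w j).
Hypothesis w01 : forall j x, (0 <= w j x <= 1)%R.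
Hypothesis wdisj : forall j k x, w j x != 0%R -> w k x != 0%R -> j = k.

(** The integral of [common_density] is [1 - v] with [v] the integral of
    [w j ^+ 2]; Bernoulli's inequality gives [(1 - v) ^+ n >= 1 - n * v >= 1 / 2]. *)
Lemma flip_error (n : nat) (j : 'I_m) (s : {ffun 'I_m -> bool})
    (P P' : probability Z R) :
  n%:R%:E * \int[PX]_x (w j x ^+ 2)%:E <= (2^-1)%:E ->
  (forall A, measurable A ->
     P A = \int[PX \x fair_coin R]_(z in A) (label_density (signed w s) z)%:E) ->
  (forall A, measurable A ->
     P' A = \int[PX \x fair_coin R]_(z in A)
       (label_density (signed w (flip j s)) z)%:E) ->
  forall E, measurable E -> (8^-1)%:E <= mpower P n (~` E) + mpower P' n E.
Proof.
move=> wn PE P'E.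
apply: (@two_point_testing _ _ _ (PX \x fair_coin R) P P' _ _
  (common_density w j s) n _ _ _ _ _ _ _ PE P'E).
- by apply: measurable_label_density; exact: measurable_signed.
- by apply: measurable_label_density; exact: measurable_signed.
- exact: measurable_common_density.
- by apply: label_density_ge0 => x; exact: signed_le1.
- by apply: label_density_ge0 => x; exact: signed_le1.
- by move=> z; exact: common_density_ge0.
- by move=> z; exact: common_density_sqr_le.
have cE := integral_common_density PX mw w01 wdisj j s.
set I := (X in _ <= X ^+ n); rewrite -/I in cE.
set V := \int[PX]_x _ in wn cE.
have I0 : 0 <= I by apply: integral_ge0 => z _; rewrite lee_fin common_density_ge0.
have V0 : 0 <= V by apply: integral_ge0 => z _; rewrite lee_fin sqr_ge0.
have Vf : V \is a fin_num.
  rewrite ge0_fin_numE// (@le_lt_trans _ _ 1) ?ltry// -cE.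
  by rewrite leeDr.
have If : I \is a fin_num.
  rewrite ge0_fin_numE// (@le_lt_trans _ _ 1) ?ltry// -cE.
  by rewrite leeDl.
move: cE wn I0 V0; rewrite -(fineK If) -(fineK Vf) -EFin_expe.
rewrite -EFinD -EFinM !lee_fin => -[cE] wn I0 V0.
have -> : fine I = (1 + - fine V)%R by lra.
suff : (1 - fine V *+ n <= (1 + - fine V) ^+ n)%R.
  by apply: le_trans; rewrite -mulr_natl; lra.
rewrite -mulNrn.
elim: n {wn} => [|n IH]; first by rewrite mulr0n addr0 expr0.
rewrite exprS mulrSr.
apply: (@le_trans _ _ ((1 + - fine V) * (1 + - fine V *+ n))%R).
  rewrite mulrDl !mul1r mulrDr mulr1 !addrA [leRHS](_ : _ =
    1 + - fine V *+ n + - fine V + (- fine V) * (- fine V *+ n))%R; last by ring.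
  by rewrite lerDl mulrnAr mulrn_wge0// mulrNN mulr_ge0.
rewrite ler_wpM2l//; lra.
Qed.

(** Averaging over an involution: the sum over [s] of [e s + e (flip j s)] is
    twice the sum of [e]. *)
Lemma sum_flip_error (n : nat) (j : 'I_m) (e : {ffun 'I_m -> bool} -> \bar R) :
  (forall s, 0 <= e s) ->
  (forall s, (8^-1)%:E <= e s + e (flip j s)) ->
  ((2 ^ m)%:R / 16)%:E <= \sum_s e s.
Proof.
move=> e0 h.
have h2 : ((2 ^ m)%:R / 8)%:E <= \sum_s (e s + e (flip j s)).
  apply: (@le_trans _ _ (\sum_(s : {ffun 'I_m -> bool}) (8^-1 : R)%:E)).
    rewrite sumEFin lee_fin sumr_const card_ffun card_bool card_ord.
    by rewrite -[leRHS]mulr_natl.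
  by apply: lee_sum => s _.
move: h2; rewrite big_split/= [X in _ + X](_ : _ = \sum_s e s); last first.
  by rewrite [RHS](reindex_inj (inv_inj (@flipK _ j))).
set S := \sum_s e s; have S0 : 0 <= S by exact: sume_ge0.
have [Soo|] := ltP S +oo; last by rewrite leye_eq => /eqP -> _; exact: leey.
have Sf : S \is a fin_num by rewrite ge0_fin_numE.
by rewrite -(fineK Sf) -EFinD !lee_fin; lra.
Qed.

(** Assouad's lemma.  The sum over the sign vectors of the excess risks is an
    integral over [x]; for [x] in the support of [w j], [flip_error] applies with
    the event that the classifier answers [s j] at [x].  A common upper bound [S]
    of the excess risks takes the place of their maximum. *)
Lemma assouad n (f : n.-tuple Z -> X -> bool) (S : \bar R) :
  classifier f ->
  (forall j, n%:R%:E * \int[PX]_x (w j x ^+ 2)%:E <= (2^-1)%:E) ->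
  (forall s (P : probability Z R), (forall A, measurable A ->
     P A = \int[PX \x fair_coin R]_(z in A) (label_density (signed w s) z)%:E) ->
   excess_risk f P (eta_of (signed w s)) <= S) ->
  (16^-1)%:E * \int[PX]_x (\sum_j w j x)%:E <= S.
Proof.
move=> cf wn hS.
have W0 x : (0 <= \sum_j w j x)%R.
  by apply: sumr_ge0 => j _; case/andP: (w01 j x).
have mW : measurable_fun setT (fun x => \sum_j w j x)%R by exact: measurable_sum.
have hP s : exists P : probability Z R, forall A, measurable A ->
    P A = \int[PX \x fair_coin R]_(z in A) (label_density (signed w s) z)%:E.
  by apply: label_law; [exact: measurable_signed|exact: signed_le1].
have [P PE] := choice hP.
pose err s x := mpower (P s) n [set t | f t x != (0 <= signed w s x)%R].
have merr s : measurable_fun setT (err s).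
  by apply: measurable_error => //; exact: measurable_signed.
have err0 s x : 0 <= err s x by exact: measure_ge0.
have key x : ((2 ^ m)%:R / 16 * \sum_j w j x)%:E <=
    \sum_s (`|signed w s x|%:E * err s x).
  under [leRHS]eq_bigr do rewrite (norm_signed w01 wdisj).
  rewrite -ge0_sume_distrr; last by move=> s _; exact: err0.
  have [[j wj]|w0] := weight_cases w x; last first.
    by rewrite big1 ?mulr0 ?mul0e// => j _; exact: w0.
  rewrite EFinM muleC lee_wpmul2l ?lee_fin//.
  apply: (@sum_flip_error n j) => // s.
  pose E := [set t : n.-tuple Z | f t x == s j].
  have mE : measurable E.
    rewrite (_ : E = [set t : n.-tuple Z | f t x != ~~ s j]); last first.
      by apply/seteqP; split => t /=; rewrite /E/=; case: (f t x); case: (s j).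
    apply: measurable_neq_bool => //.
    apply: (@measurableT_comp _ _ _ _ _ _ (fun p : n.-tuple Z * X => f p.1 p.2) _
      (fun t => (t, x))); first exact: cf.
    exact: pair2_measurable.
  have := flip_error (wn j) (PE s) (PE (flip j s)) mE.
  congr (_ <= _ + _); congr mpower; apply/seteqP; split => t;
    rewrite /E/= (sign_signed w01 wdisj _ wj) ?ffunE ?eqxx.
  - by move/negP.
  - by move/negP.
  - by case: (f t x); case: (s j).
  - by case: (f t x); case: (s j).
have hint : ((2 ^ m)%:R / 16)%:E * \int[PX]_x (\sum_j w j x)%:E <=
    \sum_s excess_risk f (P s) (eta_of (signed w s)).
  under [leRHS]eq_bigr do rewrite (excess_risk_label (measurable_signed mw _)
    (signed_le1 w01 wdisj _) (PE _) cf).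
  have mterm s : measurable_fun setT (fun x => `|signed w s x|%:E * err s x).
    apply: emeasurable_funM => //; apply/measurable_EFinP.
    by apply: measurableT_comp => //; exact: measurable_signed.
  rewrite -ge0_integral_sum//; last by move=> s x _; rewrite mule_ge0.
  rewrite -ge0_integralZl//; last 2 first.
  - exact/measurable_EFinP.
  - by move=> x _; rewrite lee_fin.
  apply: ge0_le_integral => //=.
  - by move=> x _; rewrite -EFinM lee_fin mulr_ge0.
  - by apply: measurable_funeM; exact/measurable_EFinP.
  - exact: emeasurable_sum.
  - by move=> x _; rewrite -EFinM; exact: key.
have hsum : \sum_s excess_risk f (P s) (eta_of (signed w s)) <=
    \sum_(s : {ffun 'I_m -> bool}) S.
  by apply: lee_sum => s _; apply: hS => A mA; exact: PE.
have I0 : 0 <= \int[PX]_x (\sum_j w j x)%:E.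
  by apply: integral_ge0 => x _; rewrite lee_fin.
have := le_trans hint hsum.
have : 0 <= \sum_(s : {ffun 'I_m -> bool}) S.
  by apply: le_trans hsum; apply: le_trans hint; rewrite mule_ge0// lee_fin.
have E2 : (0 < (2 ^ m)%:R :> R)%R by rewrite ltr0n expn_gt0.
set I := integral _ _ _ in I0 *.
have Ifin : I < +oo.
  apply: (@le_lt_trans _ _ (\int[PX]_x cst 1%E x)).
    apply: ge0_le_integral => //=.
    - by move=> x _; rewrite lee_fin.
    - exact/measurable_EFinP.
    - move=> x _; rewrite lee_fin -(norm_signed w01 wdisj [ffun=> true]).
      exact: signed_le1.
  by rewrite integral_cst// mul1e [X in X < _](probability_setT PX) ltry.
rewrite -(fineK (_ : I \is a fin_num)); last by rewrite ge0_fin_numE.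
case: (S) => [r| |].
- rewrite sumEFin sumr_const card_ffun card_bool card_ord -!EFinM !lee_fin => _.
  by rewrite -(mulr_natl r) -mulrA ler_pM2l// mulrC.
- by move=> _ _; exact: leey.
- rewrite (bigD1 [ffun=> true])//=.
Qed.

End assouad.

(** * Smooth compactly supported functions of one variable *)

Section quadratic.
Context (R : realType).
Implicit Types (f : R -> R) (t h x y : R).

Lemma is_derive_flat f : f 0 = 0 ->
  (forall h, `|h| <= 1 -> `|f h| <= h ^+ 2) -> is_derive (0 : R) (1 : R) f 0.
Proof.
move=> f0 fh.
have cv : h^-1 *: (f (h *: 1 + 0) - f 0) @[h --> 0^'] --> (0 : R).
  apply/cvgrPdist_le => e e0; near=> h.
  have hn0 : h != 0 by near: h; exact: nbhs_dnbhs_neq.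
  have h1 : `|h| <= 1 by near: h; exact: dnbhs0_le.
  have he : `|h| <= e by near: h; exact: dnbhs0_le.
  rewrite addr0 /GRing.scale/= mulr1 f0 subr0 sub0r normrN normrM normfV.
  rewrite mulrC ler_pdivrMr ?normr_gt0//.
  apply: (le_trans (fh _ h1)); rewrite -real_normK ?num_real// expr2.
  by rewrite ler_wpM2r.
by split; [apply/cvg_ex; exists 0|exact/cvg_lim].
Unshelve. all: by end_near. Qed.

(** The exponent is at least [2], so the positive part of a power is still
    differentiable at the origin. *)
Lemma is_derive_pos_exp e t :
  is_derive t (1 : R) (fun x => Num.max x 0 ^+ e.+2) (e.+2%:R * Num.max t 0 ^+ e.+1).
Proof.
have [t0|t0|->] := ltgtP t 0.
- rewrite expr0n/= mulr0.
  apply: (@near_eq_is_derive _ _ _ (cst 0)).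
    near=> x; rewrite max_r ?expr0n//; apply: ltW.
    by near: x; exact: lt_nbhsl.
- apply: (@near_eq_is_derive _ _ _ (fun x => x ^+ e.+2)).
    near=> x; rewrite max_l//; apply: ltW.
    by near: x; exact: lt_nbhsr.
  have := is_derive_poly ('X^(e.+2) : {poly R}) t.
  rewrite derivXn hornerMn hornerXn -mulr_natl.
  by rewrite (_ : horner _ = (fun x => x ^+ e.+2))//; apply/funext => x; rewrite hornerXn.
- rewrite expr0n/= mulr0; apply: is_derive_flat.
    by rewrite max_l// expr0n.
  move=> h h1; case: (lerP h 0) => h0; first by rewrite expr0n/= normr0 sqr_ge0.
  rewrite (gtr0_norm h0) in h1; rewrite normrX (gtr0_norm h0).
  by rewrite -addn2 exprD ler_piMl ?sqr_ge0// exprn_ile1// ltW.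
Unshelve. all: by end_near. Qed.

End quadratic.

Section taylor_tower.
Context (R : realType).
Implicit Types (F : nat -> R -> R).

(** Taylor's inequality in one variable, for a sequence of successive derivatives
    [F].  By induction on [n]: the remainder vanishes at [x], its derivative is
    the remainder of order [n] for the shifted sequence, and the mean value
    theorem gives one more factor [`|y - x|]. *)
Lemma taylor_tower F (n : nat) (M x y : R) :
  (forall s t, (s < n)%N -> is_derive t (1 : R) (F s) (F s.+1 t)) ->
  (forall t, `|F n t| <= M) ->
  `|F 0%N y - \sum_(s < n) (y - x) ^+ s / s`!%:R * F s x| <= M * `|y - x| ^+ n.
Proof.
elim: n F y => [|n IH] F y dF bF.
  by rewrite big_ord0 subr0 expr0 mulr1.
pose T m (G : nat -> R -> R) : {poly R} :=
  \sum_(s < m) (G s x / s`!%:R) *: ('X - x%:P) ^+ s.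
have TE m (G : nat -> R -> R) z :
    (T m G).[z] = \sum_(s < m) (z - x) ^+ s / s`!%:R * G s x.
  rewrite /T horner_sum; apply: eq_bigr => s _.
  by rewrite !hornerE mulrC mulrA [RHS]mulrAC.
pose G s := F s.+1.
have dT : (T n.+1 F)^`() = T n G.
  rewrite /T big_ord_recl derivD linear_sum/= expr0 alg_polyC derivC add0r.
  apply: eq_bigr => s _; rewrite derivZ /bump/= add1n deriv_exp derivXsubC mul1r.
  rewrite -scalerMnr scalerMnl /G factS natrM invfM; congr (_ *: _).
  by rewrite -mulr_natr -mulrA mulrAC mulVf ?mul1r// pnatr_eq0.
have dD z : is_derive z (1 : R) (F 0%N - horner (T n.+1 F)) (G 0%N z - (T n G).[z]).
  have d0 := dF 0%N z (ltn0Sn n).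
  by have := is_deriveB d0 (is_derive_poly (T n.+1 F) z); rewrite dT.
have bD z : `|G 0%N z - (T n G).[z]| <= M * `|z - x| ^+ n.
  rewrite TE; apply: IH => // s t sn; exact: dF.
have Dx : (F 0%N - horner (T n.+1 F)) x = 0.
  have -> : (F 0%N - horner (T n.+1 F)) x = F 0%N x - (T n.+1 F).[x] by [].
  rewrite TE big_ord_recl big1; last first.
    by move=> s _; rewrite subrr expr0n/= !mul0r.
  by rewrite expr0 fact0 divr1 mul1r addr0 subrr.
have M0 : 0 <= M by apply: le_trans (bF 0).
have cD : continuous (F 0%N - horner (T n.+1 F)).
  by move=> z; apply/differentiable_continuous/derivable1_diffP.
rewrite -TE (_ : _ - _ = (F 0%N - horner (T n.+1 F)) y)//.
have main (a b : R) : a <= b -> exists2 c, c \in `[a, b] &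
    (F 0%N - horner (T n.+1 F)) b - (F 0%N - horner (T n.+1 F)) a =
    (G 0%N c - (T n G).[c]) * (b - a).
  move=> ab; apply: MVT_segment => //.
  exact: continuous_subspaceT.
have [xy|/ltW yx] := leP x y.
  have [c + E] := main _ _ xy; rewrite in_itv/= => /andP[xc cy].
  rewrite Dx subr0 in E; rewrite E normrM exprSr mulrA ler_wpM2r//.
  apply: (le_trans (bD c)); rewrite ler_wpM2l// lerXn2r ?nnegrE//.
  by rewrite !ger0_norm ?subr_ge0// lerD2r.
have [c + E] := main _ _ yx; rewrite in_itv/= => /andP[yc cx].
rewrite Dx sub0r in E; rewrite -normrN E normrM exprSr mulrA (distrC x y) ler_wpM2r//.
apply: (le_trans (bD c)); rewrite ler_wpM2l// lerXn2r ?nnegrE//.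
by rewrite distrC (distrC y) !ger0_norm ?subr_ge0// lerB.
Qed.

End taylor_tower.

Section bump1.
Context (R : realType).
Implicit Types (t : R) (s N : nat).

(** The [s]-th derivative of the [N]-th power of the positive part of [1 - t ^+ 2]
    is the power [N - s] of that positive part times a polynomial. *)
Fixpoint bump_poly N s : {poly R} :=
  if s is s'.+1 then
    (N - s')%:R *: ((- 'X *+ 2) * bump_poly N s') + (1 - 'X^2) * (bump_poly N s')^`()
  else 1.

Definition bump N s t : R :=
  Num.max (1 - t ^+ 2) 0 ^+ (N - s) * (bump_poly N s).[t].

(** On the support of the positive part, one factor of the higher power is
    [1 - t ^+ 2]; off the support both sides vanish. *)
Lemma is_derive_bump N s t : (s.+2 <= N)%N ->
  is_derive t (1 : R) (bump N s) (bump N s.+1 t).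
Proof.
move=> sN; have [e Ne] : exists e, (N - s = e.+2)%N.
  by exists (N - s).-2; lia.
have Ne' : (N - s.+1 = e.+1)%N by lia.
pose q : {poly R} := 1 - 'X^2.
have qE x : q.[x] = 1 - x ^+ 2 by rewrite /q !hornerE.
have dq : q^`() = - 'X *+ 2.
  by rewrite /q derivB derivXn -(polyC1 R) derivC sub0r expr1 mulNrn.
have d1 := @is_derive1_comp R (fun x => Num.max x 0 ^+ e.+2) (horner q) t _ _
  (is_derive_pos_exp e q.[t]) (is_derive_poly q t).
have d2 := is_deriveM d1 (is_derive_poly (bump_poly N s) t).
rewrite (_ : bump N s =
  ((fun x => Num.max x 0 ^+ e.+2) \o horner q) * horner (bump_poly N s)); last first.
  by apply/funext => x; rewrite /bump Ne -qE.
apply: is_derive_eq d2 _.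
rewrite /bump Ne' -qE dq /= Ne /GRing.scale/= !hornerE -/q /q.
have P : Num.max (1 - t ^+ 2) 0 ^+ e.+2 = Num.max (1 - t ^+ 2) 0 ^+ e.+1 * (1 - t ^+ 2).
  rewrite exprSr; case: (lerP (1 - t ^+ 2) 0) => // h.
  by rewrite expr0n/= !mul0r.
by rewrite P /=; ring.
Qed.

Lemma bump_out N s t : (s < N)%N -> 1 <= `|t| -> bump N s t = 0.
Proof.
move=> sN t1; rewrite /bump max_r; last first.
  by rewrite subr_le0 -real_normK ?num_real// exprn_ege1.
by rewrite expr0n subn_eq0 leqNgt sN mul0r.
Qed.

Lemma bump_bounded N s : (s < N)%N -> exists M : R, forall t, `|bump N s t| <= M.
Proof.
move=> sN; exists (\sum_(i < size (bump_poly N s)) `|(bump_poly N s)`_i|) => t.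
have [t1|/ltW t1] := leP 1 `|t|.
  by rewrite bump_out// normr0 sumr_ge0.
have t2 : 0 <= 1 - t ^+ 2.
  by rewrite subr_ge0 -real_normK ?num_real// exprn_ile1.
rewrite /bump max_l// normrM -[leRHS]mul1r ler_pM//.
  rewrite ger0_norm ?exprn_ge0// exprn_ile1//.
  by rewrite gerBl sqr_ge0.
rewrite horner_coef (le_trans (ler_norm_sum _ _ _))// ler_sum// => i _.
by rewrite normrM ler_piMr// normrX exprn_ile1.
Qed.

Lemma bump0_itv N t : 0 <= bump N 0 t <= 1.
Proof.
rewrite /bump subn0 hornerC mulr1 exprn_ge0 ?le_max ?lexx ?orbT//=.
by rewrite exprn_ile1 ?le_max ?lexx ?orbT// ge_max ler01 gerBl sqr_ge0.
Qed.

Lemma bump0_half N t : `|t| <= 2^-1 -> 2^-1 ^+ N <= bump N 0 t.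
Proof.
move=> th; rewrite /bump subn0 hornerC mulr1 lerXn2r ?nnegrE ?le_max ?lexx ?orbT//.
apply/orP; left; rewrite -real_normK ?num_real//.
by have := normr_ge0 t; nra.
Qed.

(** What the construction needs to know of a bump function on the line: bounded
    derivatives up to order [k.+1], support in [[-1, 1]], values in [[0, 1]],
    and a positive lower bound [c] on [[-1/2, 1/2]]. *)
Record tower (k : nat) (F : nat -> R -> R) (M c : R) : Prop := Tower {
  tower_derive : forall s t, (s <= k)%N -> is_derive t (1 : R) (F s) (F s.+1 t);
  tower_bound : forall s t, (s <= k.+1)%N -> `|F s t| <= M;
  tower_M : 1 <= M;
  tower_out : forall s t, (s <= k.+1)%N -> 1 <= `|t| -> F s t = 0;
  tower_01 : forall t, 0 <= F 0%N t <= 1;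
  tower_c : 0 < c;
  tower_half : forall t, `|t| <= 2^-1 -> c <= F 0%N t }.

Lemma exists_tower k : exists F M c, tower k F M c.
Proof.
pose N := k.+2.
have bd (s : 'I_N) : exists M : R, forall t, `|bump N s t| <= M.
  by apply: bump_bounded.
have [m mP] := choice bd.
have m0 (s : 'I_N) : 0 <= m s by apply: le_trans (mP s 0).
exists (bump N), (1 + \sum_s m s), (2^-1 ^+ N); split.
- by move=> s t sk; apply: is_derive_bump; rewrite !ltnS.
- move=> s t sk; have sN : (s < N)%N by rewrite ltnS.
  rewrite (le_trans (mP (Ordinal sN) t))// (bigD1 (Ordinal sN))//=.
  by rewrite addrCA lerDl addr_ge0// sumr_ge0.
- by rewrite lerDl sumr_ge0.
- by move=> s t sk; apply: bump_out; rewrite ltnS.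
- exact: bump0_itv.
- by rewrite exprn_gt0// invr_gt0.
- exact: bump0_half.
Qed.

End bump1.

Section product_taylor.
Context (R : realType).

Lemma prod_diff_le (n : nat) (B e : R) (u v : 'I_n -> R) : 1 <= B -> 0 <= e ->
  (forall i, `|u i| <= B) -> (forall i, `|v i| <= B) ->
  (forall i, `|u i - v i| <= e) ->
  `|\prod_i u i - \prod_i v i| <= n%:R * B ^+ n * e.
Proof.
move=> B1 e0; have B0 : 0 <= B by apply: le_trans B1.
elim: n u v => [|n IH] u v uB vB uv.
  by rewrite !big_ord0 subrr normr0 !mul0r.
rewrite !big_ord_recl.
set U := \prod_(i < n) u _; set V := \prod_(i < n) v _.
have -> : u ord0 * U - v ord0 * V = u ord0 * (U - V) + (u ord0 - v ord0) * V by ring.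
have UV : `|U - V| <= n%:R * B ^+ n * e by apply: IH.
have VB : `|V| <= B ^+ n.
  rewrite normr_prod -[n in leRHS]card_ord -prodr_const.
  by apply: ler_prod => i _; rewrite normr_ge0 vB.
rewrite (le_trans (ler_normD _ _))// !normrM.
apply: (@le_trans _ _ (B * (n%:R * B ^+ n * e) + e * B ^+ n)).
  by rewrite lerD// ler_pM.
rewrite -natr1 exprS.
have h : B ^+ n <= B * B ^+ n by rewrite ler_peMl// exprn_ge0.
have h' : e * B ^+ n <= e * (B * B ^+ n) by rewrite ler_wpM2l.
have -> : (n%:R + 1) * (B * B ^+ n) * e =
  B * (n%:R * B ^+ n * e) + e * (B * B ^+ n) by ring.
by rewrite lerD2l.
Qed.

Variables (k d : nat) (beta : R).
Hypotheses (kb : k%:R < beta) (bk : beta <= k.+1%:R).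

Definition taylor_term (F : nat -> R -> R) (y y' : 'I_d -> R)
    (t : {ffun 'I_d -> 'I_k.+1}) : R :=
  \prod_i ((y' i - y i) ^+ t i / (t i)`!%:R * F (t i) (y i)).

(** Multiplying the one-variable Taylor polynomials produces every multi-index
    with entries at most [k].  For increments [dl <= 1], the product of the
    remainders and the multi-indices of total degree above [k] contribute at most
    a multiple of [dl ^+ k.+1], which is at most [dl `^ beta].  For [dl >= 1]
    each term is bounded by a multiple of [dl ^+ k <= dl `^ beta]. *)
Lemma product_taylor (F : nat -> R -> R) (M c : R) : tower k F M c ->
  exists2 C : R, 0 < C & forall (y y' : 'I_d -> R) (dl : R), 0 <= dl ->
    (forall i, `|y' i - y i| <= dl) ->
    `|\prod_i F 0%N (y' i) -
       \sum_(t : {ffun 'I_d -> 'I_k.+1} | (\sum_i t i <= k)%N) taylor_term F y y' t|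
    <= C * dl `^ beta.
Proof.
move=> tF; have M1 := tower_M tF; have M0 : 0 <= M by apply: le_trans M1.
pose B := k.+1%:R * M.
have B1 : 1 <= B by rewrite -[1]mulr1 ler_pM// ler1n.
have MB : M <= B by rewrite ler_peMl// ler1n.
pose Nn : R := #|{ffun 'I_d -> 'I_k.+1}|%:R.
have Nn0 : 0 <= Nn by exact: ler0n.
exists (d%:R * B ^+ d * M + Nn * M ^+ d + (1 + Nn) * M ^+ d).
  rewrite ltr_wpDl ?addr_ge0 ?mulr_ge0 ?exprn_ge0 ?(le_trans _ B1)//.
  by rewrite mulr_gt0 ?exprn_gt0 ?ltr_wpDr// (lt_le_trans _ M1).
move=> y y' dl dl0 ydl.
have beta0 : 0 < beta by apply: le_lt_trans kb.
have factor i (s : nat) : (s <= k)%N ->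
    `|(y' i - y i) ^+ s / s`!%:R * F s (y i)| <= dl ^+ s * M.
  move=> sk; rewrite normrM ler_pM//; last by apply: (tower_bound tF); lia.
  rewrite normrM normrX normfV normr_nat.
  rewrite ler_pdivrMr ?ltr0n ?fact_gt0// -[leLHS]mulr1 ler_pM ?exprn_ge0//.
    by rewrite lerXn2r ?nnegrE.
  by rewrite ler1n fact_gt0.
have term (t : {ffun 'I_d -> 'I_k.+1}) :
    `|taylor_term F y y' t| <= M ^+ d * dl ^+ (\sum_i t i)%N.
  rewrite /taylor_term normr_prod.
  apply: (@le_trans _ _ (\prod_i (dl ^+ t i * M))).
    by apply: ler_prod => i _; rewrite normr_ge0 factor// -ltnS.
  by rewrite big_split/= prodr_const card_ord mulrC -expr_sum.
have p0 : 0 <= dl `^ beta by exact: powR_ge0.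
have Md0 : 0 <= M ^+ d by rewrite exprn_ge0.
have sum_le (Q : pred {ffun 'I_d -> 'I_k.+1}) (e : R) : 0 <= e ->
    (forall t, Q t -> dl ^+ (\sum_i t i)%N <= e) ->
    `|\sum_(t | Q t) taylor_term F y y' t| <= Nn * M ^+ d * e.
  move=> e0 he; rewrite (le_trans (ler_norm_sum _ _ _))//.
  apply: (@le_trans _ _ (\sum_(t : {ffun 'I_d -> 'I_k.+1}) M ^+ d * e)).
    rewrite big_mkcond/=; apply: ler_sum => t _; case: ifPn => Qt.
      by rewrite (le_trans (term t))// ler_wpM2l// he.
    by rewrite mulr_ge0.
  by rewrite sumr_const -mulr_natl -/Nn mulrA.
have prodM : `|\prod_i F 0%N (y' i)| <= M ^+ d.
  rewrite normr_prod -[d in leRHS]card_ord -prodr_const.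
  by apply: ler_prod => i _; rewrite normr_ge0 (tower_bound tF).
have [dl1|/ltW dl1] := leP dl 1; last first.
  have hk : dl ^+ k <= dl `^ beta.
    by rewrite -powR_mulrn// ler_powR// ltW.
  have h1 : 1 <= dl `^ beta by rewrite (le_trans _ hk)// exprn_ege1.
  rewrite (le_trans (ler_normB _ _))//.
  apply: (@le_trans _ _ ((1 + Nn) * M ^+ d * dl `^ beta)); last first.
    by rewrite ler_wpM2r// lerDr addr_ge0// !mulr_ge0 ?exprn_ge0// (le_trans _ B1).
  rewrite mulrDl mul1r mulrDl lerD//.
    by rewrite (le_trans prodM)// ler_peMr.
  apply: sum_le => // t tk; rewrite (le_trans _ hk)//.
  by rewrite ler_weXn2l.
have hk : dl ^+ k.+1 <= dl `^ beta.
  rewrite -powR_mulrn//; have [->|dn0] := eqVneq dl 0.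
    by rewrite !powR0// gt_eqF// ltr0n.
  by apply: ger_powR => //; rewrite dl1 andbT lt_neqAle eq_sym dn0.
pose T i := \sum_(s < k.+1) ((y' i - y i) ^+ s / s`!%:R * F s (y i)).
have TE : \prod_i T i = \sum_(t : {ffun 'I_d -> 'I_k.+1}) taylor_term F y y' t.
  by rewrite /T bigA_distr_bigA.
rewrite (bigID (fun t : {ffun 'I_d -> 'I_k.+1} => (\sum_i t i <= k)%N))/= in TE.
have -> : \sum_(t : {ffun 'I_d -> 'I_k.+1} | (\sum_i t i <= k)%N)
      taylor_term F y y' t = \prod_i T i -
    \sum_(t : {ffun 'I_d -> 'I_k.+1} | ~~ (\sum_i t i <= k)%N) taylor_term F y y' t.
  by rewrite TE addrK.
rewrite opprB addrCA addrC (le_trans (ler_normD _ _))//.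
apply: (@le_trans _ _ ((d%:R * B ^+ d * M + Nn * M ^+ d) * dl `^ beta)); last first.
  by rewrite ler_wpM2r// lerDl mulr_ge0// addr_ge0.
rewrite mulrDl lerD//; last first.
  apply: (@le_trans _ _ (Nn * M ^+ d * dl ^+ k.+1)).
    apply: sum_le => [|t]; first by rewrite exprn_ge0.
    by rewrite -ltnNge => tk; rewrite ler_wiXn2l.
  by rewrite ler_wpM2l// mulr_ge0.
apply: (@le_trans _ _ (d%:R * B ^+ d * (M * dl ^+ k.+1))); last first.
  by rewrite mulrA ler_wpM2l// !mulr_ge0 ?exprn_ge0// (le_trans _ B1).
apply: prod_diff_le => //.
- by rewrite mulr_ge0// exprn_ge0.
- by move=> i; rewrite (le_trans _ MB)// (tower_bound tF).
- move=> i; rewrite (le_trans (ler_norm_sum _ _ _))// /B.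
  apply: (@le_trans _ _ (\sum_(s < k.+1) M)).
    apply: ler_sum => s _; rewrite (le_trans (factor _ _ _)) -1?ltnS//.
    by rewrite ler_piMl// exprn_ile1.
  by rewrite sumr_const card_ord mulr_natl.
- move=> i; apply: (@le_trans _ _ (M * `|y' i - y i| ^+ k.+1)).
    apply: taylor_tower => [s t sk|t]; first exact: (tower_derive tF).
    exact: (tower_bound tF).
  by rewrite ler_wpM2l// lerXn2r ?nnegrE.
Qed.

End product_taylor.

(** * Sums of tensor products and the Hoelder class *)

Section tensor.
Context (R : realType) (d m : nat).
Variables (F : 'I_m -> 'I_d -> nat -> R -> R) (a : 'I_m -> R) (k : nat).
Hypothesis dF : forall j i s t, (s < k)%N ->
  is_derive t (1 : R) (F j i s) (F j i s.+1 t).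
Hypothesis cF : forall j i s, (s <= k)%N -> continuous (F j i s).

(** Sums of products of one-variable functions are stable under partial
    derivatives: deriving along the coordinate [i] increments the entry [i] of
    the multi-index [s] of derivation orders. *)
Definition tensor (s : 'I_d -> nat) (x : 'rV[R]_d) : R :=
  \sum_j a j * \prod_i F j i (s i) (x ord0 i).

Definition incr (s : 'I_d -> nat) (i : 'I_d) (n : nat) : 'I_d -> nat :=
  fun i' => if i' == i then (s i' + n)%N else s i'.

(** A partial derivative is the derivative of a one-variable function. *)
Lemma is_derive_coord (f : 'rV[R]_d -> R) (g : R -> R) (i : 'I_d) x D :
  (forall h, f (h *: delta_mx ord0 i + x) = g (h + x ord0 i)) ->
  is_derive (x ord0 i) (1 : R) g D -> is_derive x (delta_mx ord0 i) f D.
Proof.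
move=> fg [dg Dg].
have E : (fun h => h^-1 *: ((f \o shift x) (h *: delta_mx ord0 i) - f x)) =
         (fun h => h^-1 *: ((g \o shift (x ord0 i)) (h *: 1) - g (x ord0 i))).
  apply/funext => h /=; rewrite fg [h *: 1]mulr1.
  by have := fg 0; rewrite scale0r !add0r => ->.
split; first by rewrite /derivable E.
by rewrite /derive E.
Qed.

Lemma is_derive_tensor s i x : (s i < k)%N ->
  is_derive x (delta_mx ord0 i) (tensor s) (tensor (incr s i 1) x).
Proof.
move=> sk.
pose c j := a j * \prod_(i' | i' != i) F j i' (s i') (x ord0 i').
apply: (@is_derive_coord _ (\sum_j (c j \*: F j i (s i)))%R).
  move=> h; rewrite /tensor fct_sumE; apply: eq_bigr => j _.
  rewrite (bigD1 i)//= !mxE !eqxx/= mulr1 /c.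
  rewrite [RHS]/GRing.scale/= mulrAC -mulrA; congr (_ * (_ * _)).
  apply: eq_bigr => i' i'i; by rewrite !mxE/= (negbTE i'i) ?andbF mulr0 add0r.
have -> : tensor (incr s i 1) x = \sum_j c j *: F j i (s i).+1 (x ord0 i).
  apply: eq_bigr => j _; rewrite (bigD1 i)//= /incr eqxx addn1.
  rewrite /c [RHS]/GRing.scale/= mulrAC -mulrA; congr (_ * (_ * _)).
  by apply: eq_bigr => i' i'i; rewrite (negbTE i'i).
by apply: is_derive_sum => j; apply: is_deriveZ; exact: dF.
Qed.

Lemma partial_tensor s i : (s i < k)%N -> partial i (tensor s) = tensor (incr s i 1).
Proof.
move=> sk; apply/funext => x; rewrite /partial.
by have [_ ->] := is_derive_tensor x sk.
Qed.

Lemma continuous_tensor s : (forall i, (s i <= k)%N) -> continuous (tensor s).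
Proof.
move=> sk; apply: continuous_big => [|j _]; first exact: add_continuous.
have cP : continuous (fun x : 'rV[R]_d => \prod_i F j i (s i) (x ord0 i)).
  apply: continuous_big => [|i _]; first exact: mul_continuous.
  move=> x.
  apply: (@continuous_comp _ _ _ (fun x : 'rV[R]_d => x ord0 i) (F j i (s i))).
    exact: coord_continuous.
  exact: cF.
by move=> x; apply: (@continuousM _ _ (cst (a j))); [exact: cst_continuous|exact: cP].
Qed.

Lemma Ck_tensor l s : (forall i, (s i + l <= k)%N) -> Ck l (tensor s).
Proof.
elim: l s => [|l IH] s sk /=.
  by apply: continuous_tensor => i; have := sk i; rewrite addn0.
have sk' i : (s i < k)%N by have := sk i; lia.
split.
- by apply: continuous_tensor => i; exact: ltnW.
- by move=> i x; have [] := is_derive_tensor x (sk' i).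
- move=> i; rewrite partial_tensor//; apply: IH => i'.
  by rewrite /incr; case: eqP => _; have := sk i'; lia.
Qed.

Lemma iter_partial_tensor n s i : (s i + n <= k)%N ->
  iter n (partial i) (tensor s) = tensor (incr s i n).
Proof.
elim: n => [|n IH] sk /=.
  by congr tensor; apply/funext => i'; rewrite /incr addn0 if_same.
rewrite IH; last by lia.
rewrite partial_tensor /incr ?eqxx; last by lia.
congr tensor; apply/funext => i'; case: eqP => // ->.
by rewrite addn1 addnS.
Qed.

Lemma mpartial_tensor t : (forall i, (t i <= k)%N) ->
  mpartial t (tensor (fun=> 0%N)) = tensor t.
Proof.
move=> tk; rewrite /mpartial.
(* Each coordinate of [r] has been derived to its final order, the others not
   at all. *)
have H (r : seq 'I_d) : uniq r ->
    foldr (fun i h => iter (t i) (partial i) h) (tensor (fun=> 0%N)) r =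
    tensor (fun i => if i \in r then t i else 0%N).
  elim: r => [|i r IH] //= /andP[ir ur].
  rewrite IH// iter_partial_tensor; last by rewrite (negbTE ir) add0n.
  congr tensor; apply/funext => i'; rewrite /incr inE.
  by case: eqP => [->|]//=; rewrite (negbTE ir).
rewrite H ?enum_uniq//; congr tensor; apply/funext => i.
by rewrite mem_enum.
Qed.

Lemma taylor_tensor x x' :
  taylor k (tensor (fun=> 0%N)) x x' =
  \sum_j a j * \sum_(t : {ffun 'I_d -> 'I_k.+1} | (\sum_i t i <= k)%N)
    \prod_i ((x' ord0 i - x ord0 i) ^+ t i / (t i)`!%:R * F j i (t i) (x ord0 i)).
Proof.
under [RHS]eq_bigr do rewrite big_distrr/=.
rewrite exchange_big/=; apply: eq_bigr => t tk.
rewrite mpartial_tensor; last by move=> i; rewrite -ltnS.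
rewrite /tensor big_distrr/=; apply: eq_bigr => j _.
rewrite mulrCA; congr (_ * _).
rewrite big_split/= big_split/=; congr (_ * _ * _).
by rewrite natr_prod prodfV.
Qed.

End tensor.

Section holder_bumps.
Context (R : realType) (d : nat).
Implicit Types (x : 'rV[R]_d).

Lemma coord_enorm x i : `|x ord0 i| <= enorm x.
Proof.
rewrite /enorm -sqrtr_sqr ler_wsqrtr// (bigD1 i)//= lerDl.
by apply: sumr_ge0 => j _; exact: sqr_ge0.
Qed.

Lemma enorm_ge0 x : 0 <= enorm x. Proof. exact: sqrtr_ge0. Qed.

Definition cube_bump (F : nat -> R -> R) (h : R) (z x : 'rV[R]_d) : R :=
  \prod_i F 0%N ((x ord0 i - z ord0 i) / h).

Definition incube (h : R) (z x : 'rV[R]_d) : bool :=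
  [forall i, `|x ord0 i - z ord0 i| < h].

Lemma cube_bump_out k F M c h z x : tower k F M c -> 0 < h -> ~~ incube h z x ->
  cube_bump F h z x = 0.
Proof.
move=> tF h0 /forallPn[i]; rewrite -leNgt => hi.
rewrite /cube_bump (bigD1 i)//= (tower_out tF) ?mul0r//.
by rewrite normrM normfV (gtr0_norm h0) ler_pdivlMr// mul1r.
Qed.

Lemma cube_bump_itv k F M c h z x : tower k F M c -> 0 <= cube_bump F h z x <= 1.
Proof.
move=> tF; have F01 i := tower_01 tF ((x ord0 i - z ord0 i) / h).
rewrite prodr_ge0/=; last by move=> i _; have /andP[] := F01 i.
by rewrite prodr_ile1// => i _; exact: F01.
Qed.

Lemma cube_bump_core k F M c h z x : tower k F M c -> 0 < h ->
  eball z (h / 2) x -> c ^+ d <= cube_bump F h z x.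
Proof.
move=> tF h0 xz; rewrite -[d in leLHS]card_ord -prodr_const.
apply: ler_prod => i _; rewrite (ltW (tower_c tF))/=; apply: (tower_half tF).
rewrite normrM normfV (gtr0_norm h0) ler_pdivrMr// mulrC.
apply: le_trans xz; have := coord_enorm (x - z) i.
by rewrite !mxE.
Qed.

(** The one-bump estimate is scaled by [h]; the factor [h `^ beta] lost in the
    Hoelder constant is compensated by the height [b].  In the sum, the remainder
    of the bump [j] vanishes unless [x] or [x'] lies in the cube [j], and each
    of the two points lies in at most one cube; hence the factor [2] in the
    constant. *)
Lemma holder_bumps (beta : R) F M c : 0 < beta -> tower (strict_floor beta) F M c ->
  exists2 C : R, 0 < C & forall (m : nat) (z : 'I_m -> 'rV[R]_d) (e : 'I_m -> R)
      (h b L : R), 0 < h -> 0 <= b -> (forall j, `|e j| <= b) ->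
    (forall x j j', incube h (z j) x -> incube h (z j') x -> j = j') ->
    C * b / h `^ beta <= L ->
    holder beta L (fun x => 1 / 2 + \sum_j e j * cube_bump F h (z j) x).
Proof.
move=> beta0 tF; set k := strict_floor beta in tF *.
have /andP[kb bk] := strict_floorP beta0; rewrite -/k in kb bk.
have [C C0 HC] := @product_taylor R k d beta kb bk F M c tF.
exists (2 * C); first by rewrite mulr_gt0.
move=> m z e h b L h0 b0 eb sep hL.
have hn0 : h != 0 by rewrite gt_eqF.
pose G (j : 'I_m) (i : 'I_d) (s : nat) (t : R) : R :=
  h^-1 ^+ s * F s ((t - z j ord0 i) / h).
(* The index [ord0] carries the constant [1 / 2], so that the whole function is
   one sum of tensor products. *)
pose FF (j : 'I_m.+1) (i : 'I_d) (s : nat) (t : R) : R :=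
  if unlift ord0 j is Some j' then G j' i s t else (s == 0%N)%:R.
pose aa (j : 'I_m.+1) : R := if unlift ord0 j is Some j' then e j' else 1 / 2.
have dG j i s t : (s <= k)%N -> is_derive t (1 : R) (G j i s) (G j i s.+1 t).
  move=> sk.
  have d1 := tower_derive tF ((t - z j ord0 i) / h) sk.
  have d2 : is_derive t (1 : R) (fun t => (t - z j ord0 i) / h) h^-1.
    rewrite (_ : (fun _ => _) = horner (h^-1 *: ('X - (z j ord0 i)%:P))).
      by have := is_derive_poly (h^-1 *: ('X - (z j ord0 i)%:P)) t;
        rewrite derivZ derivXsubC hornerZ hornerC mulr1.
    by apply/funext => u; rewrite !hornerE mulrC.
  have d3 := is_deriveZ (h^-1 ^+ s) (@is_derive1_comp R _ _ t _ _ d1 d2).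
  apply: is_derive_eq d3 _.
  by rewrite /G exprSr -mulrA (mulrC h^-1).
have dFF j i s t : (s < k)%N -> is_derive t (1 : R) (FF j i s) (FF j i s.+1 t).
  move=> sk; rewrite /FF; case: unliftP => [j' _|_].
    by apply: dG; exact: ltnW.
  exact: is_derive_cst.
have cFF j i s : (s <= k)%N -> continuous (FF j i s).
  move=> sk t; rewrite /FF; case: unliftP => [j' _|_]; last exact: cvg_cst.
  have [dd _] := dG j' i s t sk.
  exact/differentiable_continuous/derivable1_diffP.
have gE : (fun x => 1 / 2 + \sum_j e j * cube_bump F h (z j) x) =
    tensor FF aa (fun=> 0%N).
  apply/funext => x; rewrite /tensor big_ord_recl /aa /FF unlift_none.
  rewrite [X in 1 / 2 * X]big1 ?mulr1//.
  congr (_ + _); apply: eq_bigr => j _; rewrite liftK; congr (_ * _).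
  by apply: eq_bigr => i _; rewrite /G expr0 mul1r.
rewrite gE; split.
  by apply: Ck_tensor => // i; rewrite add0n.
move=> x x'; rewrite taylor_tensor// -/k /tensor -sumrB.
rewrite big_ord_recl [X in X + _](_ : _ = 0); last first.
  rewrite /aa /FF unlift_none -mulrBr.
  rewrite (bigD1 [ffun=> ord0])/=; last first.
    by rewrite big1// => i _; rewrite ffunE.
  rewrite [X in X - _]big1// [X in _ - (X + _)]big1; last first.
    by move=> i _; rewrite ffunE expr0 fact0 divr1 mulr1.
  rewrite [X in _ - (_ + X)]big1 ?addr0 ?subrr ?mulr0// => t /andP[_ tn0].
  have [i ti] : exists i, t i != ord0.
    apply/existsP; apply: contraNT tn0; rewrite negb_exists => /forallP ht.
    by apply/eqP/ffunP => i; rewrite ffunE; apply/eqP; have := ht i; rewrite negbK.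
  by rewrite -val_eqE/= in ti; rewrite (bigD1 i)//= (negbTE ti) mulr0 mul0r.
rewrite add0r.
pose y j i := (x ord0 i - z j ord0 i) / h.
pose y' j i := (x' ord0 i - z j ord0 i) / h.
pose Err j := \prod_i F 0%N (y' j i) -
  \sum_(t : {ffun 'I_d -> 'I_k.+1} | (\sum_i t i <= k)%N) taylor_term F (y j) (y' j) t.
rewrite (eq_bigr (fun j => e j * Err j)); last first.
  move=> j _; rewrite /aa /FF liftK -mulrBr; congr (_ * (_ - _)).
    by apply: eq_bigr => i _; rewrite /G expr0 mul1r.
  apply: eq_bigr => t _; apply: eq_bigr => i _; rewrite /G.
  have -> : y' j i - y j i = (x' ord0 i - x ord0 i) / h.
    by rewrite /y' /y -mulrBl; congr (_ / _); ring.
  by rewrite exprMn !mulrA; congr (_ * _); rewrite mulrAC.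
have ErrB j : `|Err j| <= C * (enorm (x' - x) / h) `^ beta.
  apply: HC; first by rewrite divr_ge0 ?enorm_ge0 ?ltW.
  move=> i; rewrite /y /y' -mulrBl normrM normfV (gtr0_norm h0) ler_pM2r ?invr_gt0//.
  rewrite (_ : _ - _ = (x' - x) ord0 i) ?coord_enorm//.
  by rewrite !mxE; ring.
have Err0 j : ~~ incube h (z j) x -> ~~ incube h (z j) x' -> Err j = 0.
  have out (u : 'rV[R]_d) : ~~ incube h (z j) u ->
      exists i, forall s, (s <= k)%N -> F s ((u ord0 i - z j ord0 i) / h) = 0.
    move=> /forallPn[i]; rewrite -leNgt => hi; exists i => s sk.
    rewrite (tower_out tF)//; first by lia.
    by rewrite normrM normfV (gtr0_norm h0) ler_pdivlMr// mul1r.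
  move=> /out[i Hi] /out[i' Hi']; rewrite /Err (bigD1 i')//= /y' Hi'// mul0r sub0r.
  rewrite big1 ?oppr0// => t _; rewrite /taylor_term (bigD1 i)//= /y Hi -1?ltnS//.
  by rewrite mulr0 mul0r.
have count (u : 'rV[R]_d) : \sum_j (incube h (z j) u)%:R <= 1 :> R.
  have [/existsP[j ju]|/existsPn H] := boolP [exists j, incube h (z j) u].
    rewrite (bigD1 j)//= ju big1 ?addr0// => j' j'j.
    by case: (boolP (incube h (z j') u)) => // /(sep _ _ _ ju) E; rewrite E eqxx in j'j.
  by rewrite big1// => j _; rewrite (negbTE (H j)).
pose Q := C * (enorm (x' - x) / h) `^ beta.
have Q0 : 0 <= Q by rewrite mulr_ge0 ?powR_ge0 ?ltW.
apply: (@le_trans _ _ (b * Q *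
  (\sum_j (incube h (z j) x)%:R + \sum_j (incube h (z j) x')%:R))).
  rewrite (le_trans (ler_norm_sum _ _ _))// -big_split/= big_distrr/=.
  apply: ler_sum => j _; rewrite normrM.
  have [jx|jx] := boolP (incube h (z j) x).
    rewrite -[leLHS]mulr1 ler_pM ?mulr_ge0//; first by rewrite ler_pM.
    by rewrite lerDl.
  have [jx'|jx'] := boolP (incube h (z j) x').
    by rewrite add0r mulr1 ler_pM.
  by rewrite Err0// normr0 mulr0 mulr_ge0// mulr_ge0.
apply: (@le_trans _ _ (b * Q * 2)).
  by apply: ler_wpM2l; [rewrite mulr_ge0|exact: (lerD (count x) (count x'))].
apply: (@le_trans _ _ (2 * C * b / h `^ beta * enorm (x' - x) `^ beta)); last first.
  by rewrite ler_wpM2r// powR_ge0.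
have hi : 0 <= h^-1 by rewrite invr_ge0 ltW.
have hV : h^-1 `^ beta = (h `^ beta)^-1.
  by rewrite -powR_inv1 ?ltW// powRAC powR_inv1 ?powR_ge0.
rewrite /Q powRM ?enorm_ge0// hV.
by rewrite le_eqVlt; apply/orP; left; apply/eqP; ring.
Qed.

End holder_bumps.

(** * Volumes and packings *)

Section geometry.
Context (R : realType) (d : nat).
Local Notation X := 'rV[R]_d.
Implicit Types (x y z : X) (r : R).

Definition box z (r : R) : set X := [set x | forall i, `|x ord0 i - z ord0 i| <= r].

Lemma boxE z r : box z r =
  [set x | forall i, z ord0 i - r <= x ord0 i <= z ord0 i + r].
Proof.
by apply/seteqP; split => x /= h i; have := h i; rewrite ler_distl.
Qed.

Lemma measurable_box z r : measurable (box z r).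
Proof.
have -> : box z r = \bigcap_(i in [set: 'I_d])
    ((fun x : X => x ord0 i) @^-1` [set` `[(z ord0 i - r), (z ord0 i + r)]]).
  rewrite boxE; apply/seteqP; split => [x /= h i _|x h i].
    by rewrite /= in_itv/=; exact: h.
  by have := h i Logic.I; rewrite /= in_itv.
apply: fin_bigcap_measurable => // i _.
by rewrite -[X in measurable X]setTI; exact: measurable_coord.
Qed.

Lemma lebesgue_box z r : 0 <= r -> lebesgue_rV (box z r) = ((2 * r) ^+ d)%:E.
Proof.
move=> r0; rewrite boxE lebesgue_rV_box; last first.
  by move=> i; rewrite lerD2l (le_trans _ r0)// oppr_le0.
congr _%:E; rewrite -[d in RHS]card_ord -prodr_const.
by apply: eq_bigr => i _; ring.
Qed.

Lemma eball_box z r : eball z r `<=` box z r.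
Proof.
move=> x xz i; apply: le_trans xz; have := coord_enorm (x - z) i.
by rewrite !mxE.
Qed.

(** The Euclidean norm is at most the square root of [d] times the sup norm, hence
    at most [d] times it; the cruder constant suffices. *)
Lemma box_eball z r : (0 < d)%N -> 0 <= r -> box z (r / d%:R) `<=` eball z r.
Proof.
move=> d0 r0 x xz; rewrite /eball/= /enorm.
have dn : 1 <= d%:R :> R by rewrite ler1n.
rewrite -[leRHS](ger0_norm r0) -sqrtr_sqr ler_wsqrtr//.
apply: (@le_trans _ _ (\sum_(i < d) (r / d%:R) ^+ 2)).
  apply: ler_sum => i _; rewrite !mxE -real_normK ?num_real//.
  by rewrite lerXn2r ?nnegrE ?divr_ge0//; exact: xz.
have dn0 : d%:R != 0 :> R by rewrite pnatr_eq0 -lt0n.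
rewrite sumr_const card_ord -(mulr_natr (_ ^+ 2)) expr2 -mulrA divfK// mulrAC -expr2.
rewrite ler_pdivrMr ?(lt_le_trans _ dn)//.
by rewrite ler_peMr// sqr_ge0.
Qed.

Lemma measurable_open (U : set X) : open U -> measurable U.
Proof. by move=> oU; exact: sub_sigma_algebra. Qed.

Lemma measurable_closed (U : set X) : closed U -> measurable U.
Proof.
move=> cU; rewrite -(setCK U); apply: measurableC; apply: measurable_open.
exact: closed_openC.
Qed.

Lemma measurable_compact (U : set X) : compact U -> measurable U.
Proof.
move=> cU; apply: measurable_closed.
by apply: compact_closed => //; exact: norm_hausdorff.
Qed.

Lemma measurable_eball z r : 0 <= r -> measurable (eball z r).
Proof.
move=> r0.
have -> : eball z r = [set x : X | (\sum_i (x ord0 i - z ord0 i) ^+ 2 <= r ^+ 2)].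
  apply/seteqP; split => x; rewrite /eball/= /enorm => h.
    have -> : \sum_i (x ord0 i - z ord0 i) ^+ 2 = \sum_i (x - z) ord0 i ^+ 2.
      by apply: eq_bigr => i _; rewrite !mxE.
    rewrite -[leLHS]sqr_sqrtr ?sumr_ge0//; last by move=> i _; exact: sqr_ge0.
    by rewrite lerXn2r// nnegrE sqrtr_ge0.
  have -> : \sum_i (x - z) ord0 i ^+ 2 = \sum_i (x ord0 i - z ord0 i) ^+ 2.
    by apply: eq_bigr => i _; rewrite !mxE.
  by rewrite -(ger0_norm r0) -sqrtr_sqr ler_wsqrtr.
pose q (x : X) := \sum_i (x ord0 i - z ord0 i) ^+ 2.
have mq : measurable_fun setT q.
  apply: measurable_sum => i; apply: measurable_funX; apply: measurable_funB => //.
  exact: measurable_coord.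
have := mq measurableT _ (measurable_itv `]-oo, (r ^+ 2)]).
by rewrite setTI; congr measurable; apply/seteqP; split => x /=; rewrite in_itv.
Qed.

Lemma lebesgue_eball_ge z r : (0 < d)%N -> 0 <= r ->
  (((2 * r / d%:R) ^+ d)%:E <= lebesgue_rV (eball z r))%E.
Proof.
move=> d0 r0; have := @lebesgue_box z (r / d%:R).
rewrite mulrA => <-; last by rewrite divr_ge0.
apply: le_measure; rewrite ?inE//; first exact: measurable_box.
  exact: measurable_eball.
exact: box_eball.
Qed.

Lemma compact_finite (A : set X) : compact A -> (lebesgue_rV A < +oo)%E.
Proof.
move=> cA; have [M [_ HM]] := compact_bounded cA.
have AB : A `<=` box 0 `|M + 1|.
  move=> x Ax i; rewrite mxE subr0.
  have h : M < `|M + 1| by rewrite (lt_le_trans _ (ler_norm _))// ltrDl.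
  apply: le_trans (HM _ h x Ax).
  rewrite [leRHS]/Num.norm/= mx_normrE.
  by apply/bigmax_geP; right => /=; exists (ord0, i).
have h : (lebesgue_rV A <= lebesgue_rV (box 0 `|M + 1|%R))%E.
  by apply: le_measure; rewrite ?inE//; [exact: measurable_compact|exact: measurable_box].
by apply: (le_lt_trans h); rewrite lebesgue_box// ltry.
Qed.

(** Volume argument: as long as the boxes of half-side [2 * h] around the points
    already chosen have total volume below that of [A] in the ball of radius
    [rho], some point of [A] in this ball lies outside all of them.  Regularity
    of [A] at [x0] bounds the latter volume from below. *)
Lemma packing (A : set X) (c0 r0 rho h : R) x0 (m : nat) :
  (0 < d)%N -> measurable A -> regular c0 r0 A -> A x0 -> 0 <= c0 ->
  0 < rho <= r0 -> 0 < h ->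
  m%:R * (4 * h) ^+ d < c0 * (2 * rho / d%:R) ^+ d ->
  exists z : 'I_m.+1 -> X, (forall j, A (z j) /\ eball x0 rho (z j)) /\
    (forall j j', j != j' -> exists i, 2 * h <= `|z j ord0 i - z j' ord0 i|).
Proof.
move=> d0 mA regA Ax0 c00 rr0 h0.
have rho0 : 0 <= rho by case/andP: rr0 => /ltW.
have ball_ge : ((c0 * (2 * rho / d%:R) ^+ d)%:E <= lebesgue_rV (A `&` eball x0 rho))%E.
  apply: le_trans (regA _ _ rr0 Ax0).
  by rewrite EFinM lee_wpmul2l ?lee_fin// lebesgue_eball_ge.
elim: m => [|m IH] hm.
  exists (fun=> x0); split => [j|j j']; last by rewrite !ord1 eqxx.
  split=> //; rewrite /eball/= subrr /enorm big1 ?sqrtr0// => i _.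
  by rewrite mxE expr0n.
have [|z [zA zsep]] := IH.
  by apply: le_lt_trans hm; rewrite ler_wpM2r ?exprn_ge0 ?mulr_ge0 ?ler_nat// ltW.
have [x [Ax xz]] : exists x, (A `&` eball x0 rho) x /\ forall j, ~ box (z j) (2 * h) x.
  apply: contrapT => nex.
  pose B (i : nat) : set X := box (z (inord i)) (2 * h).
  have mB i : measurable (B i) by exact: measurable_box.
  have sub : A `&` eball x0 rho `<=` \big[setU/set0]_(i < m.+1) B i.
    move=> x Ax; rewrite -bigcup_mkord.
    apply: contrapT => nx; apply: nex; exists x; split => // j xj; apply: nx.
    by exists (val j) => //=; rewrite /B inord_val.
  have h1 : (lebesgue_rV (A `&` eball x0 rho) <=
      lebesgue_rV (\big[setU/set0]_(i < m.+1) B i))%E.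
    apply: le_measure; rewrite ?inE//; last exact: bigsetU_measurable.
    by apply: measurableI => //; exact: measurable_eball.
  have h2 : (lebesgue_rV (\big[setU/set0]_(i < m.+1) B i) <=
      \sum_(i < m.+1) lebesgue_rV (B i))%E by exact: Boole_inequality.
  have := le_trans ball_ge (le_trans h1 h2).
  rewrite (eq_bigr (fun=> ((4 * h) ^+ d)%:E)); last first.
    by move=> j _; rewrite lebesgue_box ?mulr_ge0 ?ltW// mulrA -natrM.
  by rewrite sumEFin sumr_const card_ord lee_fin -(mulr_natl _ m.+1) leNgt hm.
exists (fun j => if unlift ord_max j is Some j' then z j' else x); split.
  by move=> j; case: unliftP => [j' _|_] //; exact: zA.
have far j : exists i, 2 * h <= `|x ord0 i - z j ord0 i|.
  have /existsNP[i /negP] := xz j; rewrite -ltNge => /ltW ?; by exists i.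
move=> j j'; case: unliftP => [k ->|->]; case: unliftP => [k' ->|->].
- by rewrite (inj_eq lift_inj) => /zsep.
- by move=> _; have [i] := far k; rewrite distrC; exists i.
- by move=> _; exact: far.
- by rewrite eqxx.
Qed.

End geometry.

(** * The marginal law at a given scale *)

(** The set [A] stays arbitrary, possibly with empty interior; the marginal law
    charges the cores and the part of [A] outside the box of half-side
    [2 * rho]. *)
Section design.
Context (R : realType) (d : nat).
Local Notation X := 'rV[R]_d.
Variables (A : set X) (x0 : X) (rho h tau mumax v : R) (m : nat) (z : 'I_m -> X).
Hypotheses (mA : measurable A) (rho0 : 0 < rho) (rho4 : 4 * rho <= 1).
Hypotheses (h0 : 0 < h) (hrho : h <= rho).
Hypotheses (tau0 : 0 <= tau) (tau1 : tau <= 1) (taumax : tau <= mumax).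
Hypothesis zball : forall j, eball x0 rho (z j).
Hypothesis zsep : forall j j', j != j' ->
  exists i, 2 * h <= `|z j ord0 i - z j' ord0 i|.

Definition core (j : 'I_m) : set X := A `&` eball (z j) (h / 2).

Definition core_indic (x : X) : R := \sum_j \1_(core j) x.

Lemma incube_inj x j j' : incube h (z j) x -> incube h (z j') x -> j = j'.
Proof.
move=> /forallP xj /forallP xj'; apply/eqP; apply: contraT => /zsep[i].
rewrite leNgt => /negP; case.
rewrite (le_lt_trans (ler_distD (x ord0 i) _ _))//.
by rewrite mulr2n mulrDl !mul1r ltrD// distrC.
Qed.

Lemma incube_box x j : incube h (z j) x -> box x0 (2 * rho) x.
Proof.
move=> /forallP xj i; rewrite (le_trans (ler_distD (z j ord0 i) _ _))//.
rewrite mulr2n mulrDl !mul1r lerD//; first exact: le_trans (ltW (xj i)) hrho.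
exact: (eball_box (zball j)).
Qed.

Lemma core_incube x j : core j x -> incube h (z j) x.
Proof.
move=> [_ xj]; apply/forallP => i; have := eball_box xj i => /le_lt_trans; apply.
by rewrite ltr_pdivrMr// ltr_pMr// ltr1n.
Qed.

Lemma measurable_core j : measurable (core j).
Proof. by apply: measurableI => //; apply: measurable_eball; rewrite divr_ge0// ltW. Qed.

Lemma core_indic_in x j : core j x -> core_indic x = 1.
Proof.
move=> xj; rewrite /core_indic (bigD1 j)//= indicE mem_set// big1 ?addr0// => j' j'j.
rewrite indicE memNset// => xj'.
by move: j'j; rewrite (incube_inj (core_incube xj) (core_incube xj')) eqxx.
Qed.

Lemma core_indic_cases x : core_indic x = 0 \/ exists2 j, core j x & core_indic x = 1.
Proof.
have [[j xj]|nx] := pselect (exists j, core j x).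
  by right; exists j => //; exact: core_indic_in xj.
left; rewrite /core_indic big1// => j _; rewrite indicE memNset// => xj.
by apply: nx; exists j.
Qed.

Lemma core_indic_itv x : 0 <= core_indic x <= 1.
Proof. by case: (core_indic_cases x) => [->|[j _ ->]]; rewrite ?lexx ler01. Qed.

Lemma measurable_core_indic : measurable_fun setT core_indic.
Proof.
by apply: measurable_sum => j; apply: measurable_indic; exact: measurable_core.
Qed.

Lemma core_indic_box x : core_indic x != 0 -> A x /\ box x0 (2 * rho) x.
Proof.
case: (core_indic_cases x) => [->|[j xj _ _]]; first by rewrite eqxx.
by split; [case: xj|exact: incube_box (core_incube xj)].
Qed.

Lemma integral_core_indic :
  (\int[lebesgue_rV]_x (core_indic x)%:E = \sum_j lebesgue_rV (core j))%E.
Proof.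
under eq_integral do rewrite /core_indic -sumEFin.
rewrite ge0_integral_sum//.
  apply: eq_bigr => j _; rewrite integral_indic ?setIT//; exact: measurable_core.
by move=> j; apply/measurable_EFinP; apply: measurable_indic; exact: measurable_core.
Qed.

Lemma box_le1 : (4 * rho) ^+ d <= 1.
Proof. by rewrite exprn_ile1// mulr_ge0// ltW. Qed.

Lemma lebesgue_bigbox : lebesgue_rV (box x0 (2 * rho)) = ((4 * rho) ^+ d)%:E.
Proof. by rewrite lebesgue_box ?mulr_ge0 ?ltW// mulrA -natrM. Qed.

Lemma integral_core_indic_le1 : (\int[lebesgue_rV]_x (core_indic x)%:E <= 1)%E.
Proof.
apply: (@le_trans _ _ (\int[lebesgue_rV]_x (\1_(box x0 (2 * rho)) x)%:E)%E).
  apply: ge0_le_integral => //=.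
  - by move=> x _; rewrite lee_fin; case/andP: (core_indic_itv x).
  - by apply/measurable_EFinP; exact: measurable_core_indic.
  - by apply/measurable_EFinP; apply: measurable_indic; exact: measurable_box.
  - move=> x _; rewrite lee_fin.
    have [->//|/core_indic_box[_ xb]] := eqVneq (core_indic x) 0.
    by rewrite indicE mem_set//; case/andP: (core_indic_itv x).
rewrite integral_indic// ?setIT; last exact: measurable_box.
by rewrite [X in (X <= _)%E]lebesgue_bigbox lee_fin box_le1.
Qed.

Hypotheses (v0 : 0 < v) (v1 : 1 <= mumax * v).
Hypothesis Vv : lebesgue_rV (A `\` box x0 (2 * rho)) = v%:E.

(** Constant density [tau] on the cores, and constant density [nu] on the part of
    [A] outside the box, where [nu] is fixed by the total mass.  The inequality
    [1 <= mumax * v] keeps [nu] below [mumax]. *)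
Lemma exists_design : exists (PX : probability X R) (mu : X -> R),
  [/\ measurable_fun setT mu, forall x, 0 <= mu x <= mumax,
      forall B, measurable B -> PX B = (\int[lebesgue_rV]_(x in B) (mu x)%:E)%E,
      PX A = 1%E &
      forall x, box x0 (2 * rho) x -> mu x = tau * core_indic x].
Proof.
pose I1 := (\int[lebesgue_rV]_x (core_indic x)%:E)%E.
have I1ge0 : (0 <= I1)%E.
  by apply: integral_ge0 => x _; rewrite lee_fin; case/andP: (core_indic_itv x).
have I1f : I1 \is a fin_num.
  by rewrite ge0_fin_numE// (le_lt_trans integral_core_indic_le1)// ltry.
have s0 : 0 <= fine I1 by exact: fine_ge0.
have s1 : fine I1 <= 1 by rewrite -lee_fin fineK//; exact: integral_core_indic_le1.
pose V := A `\` box x0 (2 * rho).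
have mV : measurable V by apply: measurableD => //; exact: measurable_box.
pose nu := (1 - tau * fine I1) / v.
have ts : tau * fine I1 <= 1 by rewrite mulr_ile1.
have nu0 : 0 <= nu by rewrite divr_ge0 ?subr_ge0// ltW.
have nu1 : nu <= mumax.
  rewrite ler_pdivrMr// (le_trans _ v1)// gerBl.
  by rewrite mulr_ge0.
pose mu x := tau * core_indic x + nu * \1_V x.
have mV1 : measurable_fun setT (\1_V : X -> R) by exact: measurable_indic.
have mmu : measurable_fun setT mu.
  apply: measurable_funD; apply: measurable_funM => //.
  exact: measurable_core_indic.
have mubox x : box x0 (2 * rho) x -> mu x = tau * core_indic x.
  by move=> xb; rewrite /mu indicE memNset ?mulr0 ?addr0// => -[].
have mu_itv x : 0 <= mu x <= mumax.
  have /andP[c0 c1] := core_indic_itv x.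
  rewrite /mu indicE; have [xV|xV] := boolP (x \in V).
    have -> : core_indic x = 0.
      apply/eqP; apply: contraT => /core_indic_box[_ xb].
      by move: xV; rewrite inE => -[].
    by rewrite mulr0 add0r mulr1 nu0 nu1.
  rewrite mulr0 addr0 mulr_ge0//= (le_trans _ taumax)//.
  by rewrite ler_piMr.
have muA x : ~ A x -> mu x = 0.
  move=> nA; rewrite /mu indicE memNset; last by case.
  have -> : core_indic x = 0 by apply/eqP; apply: contraT => /core_indic_box[].
  by rewrite !mulr0 addr0.
have mu0 x : 0 <= mu x by case/andP: (mu_itv x).
have int1 : (\int[lebesgue_rV]_x (mu x)%:E = 1)%E.
  rewrite ge0_integral_lin//; last 2 first.
  - exact: measurable_core_indic.
  - by move=> x; case/andP: (core_indic_itv x).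
  transitivity (tau%:E * (fine I1)%:E + nu%:E * v%:E)%E.
    congr (_ * _ + _ * _)%E; first by rewrite fineK.
    by rewrite integral_indic// setIT; exact: Vv.
  rewrite -!EFinM -EFinD.
  by rewrite /nu divfK ?gt_eqF// subrKC.
have [P0 P0E] := density_measure lebesgue_rV mmu mu0.
have P01 : P0 setT = 1%E by rewrite P0E.
have [PX PXE] := probability_of_measure P01.
exists PX, mu; split => //.
  by move=> B _; rewrite PXE P0E.
rewrite PXE P0E integral_mkcond -[RHS]int1; apply: eq_integral => x _.
rewrite patchE; case: ifPn => // /negP; rewrite inE => nA.
by rewrite muA.
Qed.

End design.

(** * The lower bound at a given scale *)

Section scale.
Context (R : realType) (d : nat).
Local Notation X := 'rV[R]_d.
Local Notation Z := ('rV[R]_d * bool)%type.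
Variables (L beta alpha c0 r0 C0 mumax : R) (K A : set X).
Variables (F : nat -> R -> R) (M c Cst : R).
Hypotheses (alpha0 : 0 < alpha) (C00 : 0 < C0).
Hypotheses (tF : tower (strict_floor beta) F M c).
Hypothesis HCst : forall (m : nat) (z : 'I_m -> 'rV[R]_d) (e : 'I_m -> R)
      (h b L : R), 0 < h -> 0 <= b -> (forall j, `|e j| <= b) ->
    (forall x j j', incube h (z j) x -> incube h (z j') x -> j = j') ->
    Cst * b / h `^ beta <= L ->
    holder beta L (fun x => 1 / 2 + \sum_j e j * cube_bump F h (z j) x).
Hypotheses (cA : compact A) (AK : A `<=` K) (rA : regular c0 r0 A).
Variables (x0 : X) (rho h tau b v : R) (m : nat) (z : 'I_m -> X).
Hypotheses (rho0 : 0 < rho) (rho4 : 4 * rho <= 1).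
Hypotheses (h0 : 0 < h) (hrho : h <= rho).
Hypotheses (tau0 : 0 <= tau) (tau1 : tau <= 1) (taumax : tau <= mumax).
Hypothesis zball : forall j, eball x0 rho (z j).
Hypothesis zsep : forall j j', j != j' ->
  exists i, 2 * h <= `|z j ord0 i - z j' ord0 i|.
Hypotheses (v0 : 0 < v) (v1 : 1 <= mumax * v).
Hypothesis Vv : lebesgue_rV (A `\` box x0 (2 * rho)) = v%:E.
Hypotheses (b0 : 0 <= b) (b1 : b <= 1).
Hypothesis tau_margin : tau <= C0 * (b * c ^+ d / 2) `^ alpha.
Hypothesis hL : Cst * b / h `^ beta <= L.

Let mA : measurable A := measurable_compact cA.

Definition weight (j : 'I_m) (x : X) : R := b * cube_bump F h (z j) x.

Lemma weight01 j x : 0 <= weight j x <= 1.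
Proof.
have /andP[u0 u1] := cube_bump_itv h (z j) x tF.
by rewrite /weight mulr_ge0//= mulr_ile1.
Qed.

Lemma weight_le j x : weight j x <= b.
Proof.
have /andP[u0 u1] := cube_bump_itv h (z j) x tF.
by rewrite /weight ler_piMr.
Qed.

Lemma weight_incube j x : weight j x != 0 -> incube h (z j) x.
Proof.
by apply: contraR => /(cube_bump_out tF h0); rewrite /weight => ->; rewrite mulr0.
Qed.

Lemma weight_disj j j' x : weight j x != 0 -> weight j' x != 0 -> j = j'.
Proof. by move=> /weight_incube xj /weight_incube; exact: (incube_inj zsep). Qed.

Lemma measurable_weight j : measurable_fun setT (weight j).
Proof.
apply: measurable_funM => //; apply: measurable_prod => i _.
apply: (@measurableT_comp _ _ _ _ _ _ (F 0%N)).
  apply: continuous_measurable_fun => t.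
  have [dd _] := tower_derive tF t (leq0n _).
  exact/differentiable_continuous/derivable1_diffP.
apply: measurable_funM => //; apply: measurable_funB => //.
exact: measurable_coord.
Qed.

Lemma weight_core j x : core A h z j x -> b * c ^+ d <= weight j x.
Proof.
by move=> [_ xj]; rewrite /weight ler_wpM2l//; exact: cube_bump_core tF h0 xj.
Qed.

Lemma total_weight_core j x : core A h z j x -> b * c ^+ d <= \sum_k weight k x.
Proof.
move=> xj; rewrite (le_trans (weight_core xj))// (bigD1 j)//= lerDl sumr_ge0// => k _.
by case/andP: (weight01 k x).
Qed.

Section law.
Variables (PX : probability X R) (mu : X -> R).
Hypotheses (mmu : measurable_fun setT mu) (mu_itv : forall x, 0 <= mu x <= mumax).
Hypothesis PXE : forall B, measurable B ->
  PX B = (\int[lebesgue_rV]_(x in B) (mu x)%:E)%E.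
Hypothesis PXA : PX A = 1%E.
Hypothesis mubox : forall x, box x0 (2 * rho) x -> mu x = tau * core_indic A h z x.

Let mu0 x : 0 <= mu x. Proof. by case/andP: (mu_itv x). Qed.

Lemma mu_le_tau x : box x0 (2 * rho) x -> mu x <= tau.
Proof.
move=> xb; rewrite mubox// ler_piMr//.
by case/andP: (core_indic_itv A h0 zsep x).
Qed.

(** The gap between the regression function and [1 / 2] is half the total weight.
    For [t] below half of [b * c ^+ d], the points whose gap is positive and at
    most [t] are in the big box but outside the cores, where the law has no mass.
    For larger [t], the mass of the big box is at most [tau]. *)
Lemma margin_signed s (P : probability Z R) :
  (forall B, measurable B -> marginal P B = PX B) ->
  margin alpha C0 P (eta_of (signed weight s)).
Proof.
move=> PPX t t0.
set S := [set x | _].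
have mphi := measurable_signed measurable_weight s.
have mS : measurable S.
  pose q (x : X) := `|eta_of (signed weight s) x - 1 / 2|.
  have mq : measurable_fun setT q.
    apply: measurableT_comp => //; apply: measurable_funB => //.
    by apply: measurable_funM => //; exact: measurable_funD.
  have := mq measurableT _ (measurable_itv `]0, t]).
  by rewrite setTI; congr measurable; apply/seteqP; split => x /=; rewrite in_itv.
have SW x : S x -> 0 < (\sum_j weight j x) / 2 <= t.
  rewrite /S/= /eta_of (_ : _ - _ = signed weight s x / 2); last by lra.
  rewrite normrM (norm_signed weight01 weight_disj).
  by rewrite [X in _ * X]ger0_norm// invr_ge0.
have Sbox x : S x -> box x0 (2 * rho) x.
  move=> /SW /andP[W0 _]; have [[j wj]|w0] := weight_cases weight x.
    exact: (incube_box hrho zball (weight_incube wj)).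
  by move: W0; rewrite big1// mul0r ltxx.
rewrite PPX// PXE// integral_mkcond.
have [tb|bt] := ltP t (b * c ^+ d / 2).
  rewrite integral0_eq; first by rewrite lee_fin mulr_ge0 ?powR_ge0// ltW.
  move=> x _; rewrite patchE; case: ifPn => //; rewrite inE => xS; congr _%:E.
  rewrite mubox; last exact: Sbox.
  case: (core_indic_cases A h0 zsep x) => [->|[j xj _]]; first by rewrite mulr0.
  have := total_weight_core xj; have /andP[_] := SW _ xS; move: tb; lra.
apply: (@le_trans _ _ (\int[lebesgue_rV]_x (tau * \1_(box x0 (2 * rho)) x)%:E)%E).
  apply: ge0_le_integral => //=.
  - by move=> x _; apply: erestrict_ge0 => y _; rewrite lee_fin.
  - apply/(measurable_restrictT _ _).1 => //.
    by apply: measurable_funTS; exact/measurable_EFinP.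
  - apply/measurable_EFinP; apply: measurable_funM => //.
    by apply: measurable_indic; exact: measurable_box.
  - move=> x _; rewrite patchE; case: ifPn; rewrite ?inE => xS.
      rewrite lee_fin indicE mem_set ?mulr1; last exact: Sbox.
      by apply: mu_le_tau; exact: Sbox.
    by rewrite lee_fin mulr_ge0.
under eq_integral do rewrite EFinM.
rewrite ge0_integralZl//; last first.
  by apply/measurable_EFinP; apply: measurable_indic; exact: measurable_box.
rewrite integral_indic//; last exact: measurable_box.
rewrite setIT [X in (_ * X <= _)%E](lebesgue_bigbox x0 rho0) -EFinM lee_fin.
apply: (@le_trans _ _ tau).
  by rewrite ler_piMr// (box_le1 d rho0 rho4).
rewrite (le_trans tau_margin)// ler_wpM2l ?(ltW C00)//.
have bc : 0 <= b * c ^+ d / 2.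
  by rewrite divr_ge0// mulr_ge0// exprn_ge0// ltW// (tower_c tF).
by rewrite ge0_ler_powR ?nnegrE ?(ltW alpha0) ?(ltW t0).
Qed.

Lemma holder_signed s : holder beta L (eta_of (signed weight s)).
Proof.
rewrite (_ : eta_of _ =
    (fun x => 1 / 2 +
       \sum_j (label_sign R (s j) * b / 2) * cube_bump F h (z j) x)); last first.
  apply/funext => x; rewrite /eta_of /signed mulrDl big_distrl/=; congr (_ + _).
  by apply: eq_bigr => j _; rewrite /weight; ring.
apply: (HCst h0 b0 _ _ hL).
  move=> j; rewrite -mulrA normrM.
  have -> : `|label_sign R (s j)| = 1 by case: (s j); rewrite /label_sign ?normrN normr1.
  by rewrite mul1r ger0_norm ?divr_ge0// ler_pdivrMr// ler_peMr// ler1n.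
by move=> x j j'; exact: (incube_inj zsep).
Qed.

Lemma integral_PX (f : X -> R) : measurable_fun setT f -> (forall x, 0 <= f x) ->
  (\int[PX]_x (f x)%:E = \int[lebesgue_rV]_x (f x * mu x)%:E)%E.
Proof.
move=> mf f0; rewrite (integral_density mmu mu0 PXE)//.
exact/measurable_EFinP.
Qed.

(** Controls the information that one observation carries about the sign [j]. *)
Lemma integral_weight2 j :
  (\int[PX]_x (weight j x ^+ 2)%:E <= (tau * b ^+ 2 * (2 * h) ^+ d)%:E)%E.
Proof.
rewrite integral_PX; last 2 first.
- by apply: measurable_funX; exact: measurable_weight.
- by move=> x; exact: sqr_ge0.
apply: (@le_trans _ _
  (\int[lebesgue_rV]_x ((tau * b ^+ 2)%:E * (\1_(box (z j) h) x)%:E))%E).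
  apply: ge0_le_integral => //=.
  - by move=> x _; rewrite lee_fin mulr_ge0// sqr_ge0.
  - apply/measurable_EFinP; apply: measurable_funM => //.
    by apply: measurable_funX; exact: measurable_weight.
  - apply: measurable_funeM; apply/measurable_EFinP; apply: measurable_indic.
    exact: measurable_box.
  - move=> x _; rewrite -EFinM lee_fin.
    have [->|wj] := eqVneq (weight j x) 0.
      by rewrite expr0n/= mul0r mulr_ge0// mulr_ge0// sqr_ge0.
    have xj := weight_incube wj.
    rewrite indicE mem_set; last by move=> i; have /forallP/(_ i)/ltW := xj.
    rewrite mulr1 mulrC ler_pM ?sqr_ge0//.
      by apply: mu_le_tau; exact: (incube_box hrho zball xj).
    rewrite lerXn2r ?nnegrE ?weight_le//.
    by case/andP: (weight01 j x).
rewrite ge0_integralZl//; last 2 first.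
- by apply/measurable_EFinP; apply: measurable_indic; exact: measurable_box.
- by rewrite lee_fin mulr_ge0// sqr_ge0.
rewrite integral_indic//; last exact: measurable_box.
by rewrite setIT [X in (_ * X <= _)%E](lebesgue_box _ (ltW h0)) -EFinM.
Qed.

Lemma integral_total_weight :
  ((tau * (b * c ^+ d))%:E * (\sum_j lebesgue_rV (core A h z j)) <=
   \int[PX]_x (\sum_j weight j x)%:E)%E.
Proof.
have W0 x : 0 <= \sum_j weight j x.
  by apply: sumr_ge0 => j _; case/andP: (weight01 j x).
have mW : measurable_fun setT (fun x => \sum_j weight j x).
  by apply: measurable_sum => j; exact: measurable_weight.
have k0 : 0 <= tau * (b * c ^+ d).
  by rewrite mulr_ge0// mulr_ge0// exprn_ge0// ltW// (tower_c tF).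
have co0 x : 0 <= core_indic A h z x by case/andP: (core_indic_itv A h0 zsep x).
have mco := measurable_core_indic z mA h0.
rewrite integral_PX// -(integral_core_indic z mA h0) -ge0_integralZl//; last 2 first.
- exact/measurable_EFinP.
- by move=> x _; rewrite lee_fin.
apply: ge0_le_integral => //=.
- by move=> x _; rewrite -EFinM lee_fin mulr_ge0.
- by apply: measurable_funeM; exact/measurable_EFinP.
- by apply/measurable_EFinP; exact: measurable_funM.
move=> x _; rewrite -EFinM lee_fin.
have [E|[j xj E]] := core_indic_cases A h0 zsep x.
  by rewrite E mulr0 mulr_ge0.
rewrite mubox; last exact: (incube_box hrho zball (core_incube h0 xj)).
rewrite E !mulr1 mulrC ler_wpM2r//; exact: total_weight_core xj.
Qed.

End law.

Lemma lower_bound_at_scale n (f : n.-tuple Z -> X -> bool) : classifier f ->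
  n%:R * (tau * b ^+ 2 * (2 * h) ^+ d) <= 2^-1 ->
  ((16^-1)%:E * ((tau * (b * c ^+ d))%:E * (\sum_j lebesgue_rV (core A h z j))) <=
   ereal_sup [set e | exists (P : probability Z R) (eta : X -> R),
     PSigma' alpha c0 r0 C0 beta L mumax K P eta /\ e = excess_risk f P eta])%E.
Proof.
move=> cf hn.
have [PX [mu [mmu mu_itv PXE PXA mubox]]] :=
  exists_design mA rho0 rho4 h0 hrho tau0 tau1 taumax zball zsep v0 v1 Vv.
apply: (@le_trans _ _ ((16^-1)%:E * \int[PX]_x (\sum_j weight j x)%:E)%E).
  rewrite lee_wpmul2l ?lee_fin//.
  exact: (integral_total_weight mmu mu_itv PXE mubox).
apply: (assouad measurable_weight weight01 weight_disj cf).
  move=> j; apply: (@le_trans _ _ (n%:R * (tau * b ^+ 2 * (2 * h) ^+ d))%:E).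
    rewrite EFinM lee_wpmul2l ?lee_fin//.
    exact: (integral_weight2 mmu mu_itv PXE mubox).
  by rewrite lee_fin.
move=> s P PE; apply: ereal_sup_ubound; exists P, (eta_of (signed weight s)); split => //.
have mphi := measurable_signed measurable_weight s.
have phi1 := signed_le1 weight01 weight_disj s.
have PPX := marginal_label mphi phi1 PE.
split.
- exact: (regression_label mphi phi1 PE).
- exact: (margin_signed mmu mu_itv PXE mubox s PPX).
- exact: holder_signed.
exists A; split => //; first by rewrite PPX.
exists mu; split => //.
- by move=> x; case/andP: (mu_itv x).
- by move=> B mB; rewrite PPX// PXE.
- by move=> x _; case/andP: (mu_itv x).
Qed.

End scale.

(** * Choice of the scale *)

Section parameters.
Context (R : realType).
Implicit Types (alpha beta rho : R) (n d : nat).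

(** The exponent [D] balances [n] against the information
    [h `^ (alpha * beta + 2 * beta + d)] carried by one observation. *)
Lemma scale_exponents alpha beta rho n d :
  0 < alpha -> 0 < beta -> 0 < rho -> rho <= 1 -> (0 < n)%N ->
  let D := (2 + alpha) * beta + d%:R in
  let h := rho * n%:R `^ (- D^-1) in
  [/\ 0 < h, h <= rho,
      n%:R * (h `^ (alpha * beta) * (h `^ beta) ^+ 2 * h ^+ d) <= 1 &
      h `^ (alpha * beta) * h `^ beta =
      rho `^ ((1 + alpha) * beta) * n%:R `^ (- ((1 + alpha) * beta / D))].
Proof.
move=> a0 b0 r0 r1 n0 D h.
have D0 : 0 < D by rewrite ltr_wpDr// mulr_gt0// addr_gt0.
have nR : 0 < n%:R :> R by rewrite ltr0n.
have n1 : 1 <= n%:R :> R by rewrite ler1n.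
have p0 : 0 < n%:R `^ (- D^-1) :> R by exact: powR_gt0.
have h0 : 0 < h by rewrite mulr_gt0.
have hE : h `^ (alpha * beta) * h `^ beta = h `^ ((1 + alpha) * beta).
  rewrite -powRD; last by rewrite (gt_eqF h0) implybT.
  by congr powR; ring.
split => //.
- rewrite /h ler_piMr ?(ltW r0)// powRN invf_le1 ?powR_gt0//.
  by rewrite -[leLHS](powRr0 n%:R); apply: ler_powR => //; rewrite invr_ge0 ltW.
- have -> : h `^ (alpha * beta) * (h `^ beta) ^+ 2 * h ^+ d = h `^ D.
    rewrite expr2 mulrA hE -powRD; last by rewrite (gt_eqF h0) implybT.
    rewrite -(powR_mulrn d (ltW h0)) -powRD; last by rewrite (gt_eqF h0) implybT.
    by congr powR; rewrite /D; ring.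
  rewrite /h powRM ?(ltW r0) ?(ltW p0)// -powRrM mulNr mulVf ?gt_eqF//.
  rewrite powR_inv1 ?(ltW nR)// mulrCA divff ?gt_eqF// mulr1.
  by rewrite -[leRHS](powRr0 rho); apply: ger_powR; [rewrite r0|exact: ltW].
rewrite hE /h powRM ?(ltW r0) ?(ltW p0)// -powRrM; congr (_ * _ `^ _).
by rewrite mulNr mulrC.
Qed.

Lemma exists_truncation (q : R) : 0 < q ->
  exists m : nat, m%:R < q /\ q / 2 <= m.+1%:R.
Proof.
move=> q0; exists (Num.truncn (q / 2)).
have q2 : 0 <= q / 2 by rewrite divr_ge0// ltW.
have /andP[h1 h2] := truncn_itv q2.
split; last exact: ltW.
by rewrite (le_lt_trans h1)// ltr_pdivrMr// ltr_pMr// ltr1n.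
Qed.

End parameters.

Section localization.
Context (R : realType) (d : nat).
Local Notation X := 'rV[R]_d.

(** A small box removes little volume, so the strict inequality
    [1 < mumax * lambda(A)] survives, in the weak form, for the rest of [A]. *)
Lemma exists_small_box (A : set X) (mumax r0 : R) : (0 < d)%N -> compact A ->
  0 < mumax -> 0 < r0 -> (1 < mumax%:E * lebesgue_rV A)%E ->
  exists (x0 : X) (rho v : R), [/\ A x0, 0 < rho /\ 4 * rho <= 1, rho <= r0,
    0 < v /\ 1 <= mumax * v & lebesgue_rV (A `\` box x0 (2 * rho)) = v%:E].
Proof.
move=> d0 cA mu0 r00 rich.
have mA := measurable_compact cA.
have Af : lebesgue_rV A \is a fin_num.
  by rewrite ge0_fin_numE//; exact: compact_finite.
pose a := fine (lebesgue_rV A).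
have aE : lebesgue_rV A = a%:E by rewrite fineK.
have a1 : 1 < mumax * a by rewrite -lte_fin EFinM -aE.
pose eps := a - mumax^-1.
have eps0 : 0 < eps by rewrite subr_gt0 -(ltr_pM2l mu0) divff ?gt_eqF.
have [x0 Ax0] : exists x, A x.
  apply/set0P/eqP => A0; move: rich; rewrite A0 measure0 mule0.
  by rewrite lte_fin ltr10.
pose rho := Num.min (Num.min r0 4^-1) (eps / 4).
have rho0 : 0 < rho by rewrite !lt_min r00 invr_gt0 ltr0n/= divr_gt0.
have rho4 : 4 * rho <= 1.
  by rewrite -ler_pdivlMl// mulr1 !ge_min lexx orbT.
have rhoe : 4 * rho <= eps.
  by rewrite -ler_pdivlMl// mulrC ge_min lexx orbT.
have rhor : rho <= r0 by rewrite !ge_min lexx.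
have mG : measurable (box x0 (2 * rho)) by exact: measurable_box.
have mV : measurable (A `\` box x0 (2 * rho)) by exact: measurableD.
have Vle : (lebesgue_rV (A `\` box x0 (2 * rho)) <= lebesgue_rV A)%E.
  by apply: le_measure; rewrite ?inE//; exact: subDsetl.
have Vf : lebesgue_rV (A `\` box x0 (2 * rho)) \is a fin_num.
  by rewrite ge0_fin_numE// (le_lt_trans Vle)// aE ltry.
pose v := fine (lebesgue_rV (A `\` box x0 (2 * rho))).
have vE : lebesgue_rV (A `\` box x0 (2 * rho)) = v%:E by rewrite fineK.
have av : a <= v + eps.
  apply: (@le_trans _ _ (v + (4 * rho) ^+ d)); last first.
    rewrite lerD2l (le_trans _ rhoe)// -[leRHS]expr1 ler_wiXn2l//.
    by rewrite mulr_ge0// ltW.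
  have big : lebesgue_rV (box x0 (2 * rho)) = ((4 * rho) ^+ d)%:E.
    exact: lebesgue_bigbox.
  rewrite -lee_fin EFinD -aE -vE -big.
  apply: (@le_trans _ _ (lebesgue_rV ((A `\` box x0 (2 * rho)) `|` box x0 (2 * rho)))).
    apply: le_measure; rewrite ?inE//; first exact: measurableU.
    by move=> x Ax; have [xb|xb] := pselect (box x0 (2 * rho) x); [right|left].
  exact: measureU2.
have vmu : mumax^-1 <= v by move: av; rewrite /eps; lra.
exists x0, rho, v; split => //; split.
  by rewrite (lt_le_trans _ vmu)// invr_gt0.
by rewrite -(divff (_ : mumax != 0)) ?gt_eqF// ler_pM2l.
Qed.

End localization.

Theorem theorem4p1 (R : realType) (d : nat) (L beta alpha : R)
    (c0 r0 C0 mumax : R) (K : set 'rV[R]_d) :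
  (1 <= d)%N -> 0 < L -> 0 < beta -> 0 < alpha ->
  0 < c0 -> 0 < r0 -> 0 < C0 -> 0 < mumax -> compact K ->
  rich_class c0 r0 mumax K ->
  exists2 C : R, 0 < C &
    forall (n : nat) (f : n.-tuple ('rV[R]_d * bool) -> 'rV[R]_d -> bool),
      (1 <= n)%N -> classifier f ->
      ((C * n%:R `^ (- ((1 + alpha) * beta / ((2 + alpha) * beta + d%:R))))%:E
       <= ereal_sup [set e | exists (P : probability ('rV[R]_d * bool)%type R)
                               (eta : 'rV[R]_d -> R),
                             PSigma' alpha c0 r0 C0 beta L mumax K P eta /\
                             e = excess_risk f P eta])%E.
Proof.
move=> d0 L0 beta0 alpha0 c00 r00 C00 mu0 cK [A [cA AK rA rich]].
have [F [M [c tF]]] := exists_tower R (strict_floor beta).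
have [Cst Cst0 HC] := holder_bumps d beta0 tF.
have [x0 [rho [v [Ax0 [rho0 rho4] rhor [v0 v1] Vv]]]] :=
  exists_small_box d0 cA mu0 r00 rich.
have mA := measurable_compact cA.
have c_gt0 := tower_c tF.
have dR : 0 < d%:R :> R by rewrite ltr0n.
have rho1 : rho <= 1 by move: rho4; lra.
pose b0 := Num.min 1 (L / Cst).
have b00 : 0 < b0 by rewrite lt_min ltr01 divr_gt0.
have b01 : b0 <= 1 by rewrite ge_min lexx.
have b0L : Cst * b0 <= L by rewrite -ler_pdivlMl// mulrC ge_min lexx orbT.
pose bc := b0 * c ^+ d / 2.
have bc0 : 0 < bc by rewrite divr_gt0// mulr_gt0// exprn_gt0.
(* The four bounds on [tau0] serve, in order: the total mass, the bound on the
   density, the margin condition, and the indistinguishability of the laws. *)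
pose tau0 := Num.min (Num.min 1 mumax) (Num.min (C0 * bc `^ alpha) (2^-1 ^+ d.+1)).
have tau00 : 0 < tau0.
  by rewrite !lt_min ltr01 mu0 mulr_gt0 ?powR_gt0//= exprn_gt0// invr_gt0.
have tau01 : tau0 <= 1 by rewrite !ge_min lexx.
have tau0mu : tau0 <= mumax by rewrite !ge_min lexx !orbT.
have tau0m : tau0 <= C0 * bc `^ alpha by rewrite !ge_min lexx !orbT.
have tau0d : tau0 <= 2^-1 ^+ d.+1 by rewrite !ge_min lexx !orbT.
pose Kp := c0 * (2 * rho / d%:R) ^+ d.
have Kp0 : 0 < Kp by rewrite mulr_gt0// exprn_gt0// divr_gt0// mulr_gt0.
pose kappa := Kp * c0 / (2 * (4 * d%:R) ^+ d).
have kappa0 : 0 < kappa.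
  apply: divr_gt0; first exact: mulr_gt0.
  by apply: mulr_gt0 => //; apply: exprn_gt0; exact: mulr_gt0.
exists (16^-1 * (tau0 * (b0 * c ^+ d) * kappa) * rho `^ ((1 + alpha) * beta)).
  by repeat apply: mulr_gt0 => //; rewrite ?invr_gt0 ?exprn_gt0 ?powR_gt0.
move=> n f n1 cf.
have [] := scale_exponents d alpha0 beta0 rho0 rho1 n1.
set D := (2 + alpha) * beta + d%:R; set h := rho * _ => h0 hrho hn hrate; clearbody h.
have h1 : h <= 1 by rewrite (le_trans hrho).
have hb0 : 0 < h `^ beta by exact: powR_gt0.
have hb1 : h `^ beta <= 1.
  by rewrite -[leRHS](powRr0 h); apply: ger_powR; [rewrite h0|exact: ltW].
have hab0 : 0 < h `^ (alpha * beta) by exact: powR_gt0.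
have hab1 : h `^ (alpha * beta) <= 1.
  by rewrite -[leRHS](powRr0 h); apply: ger_powR; rewrite ?h0// mulr_ge0 ?ltW.
pose b := b0 * h `^ beta; pose tau := tau0 * h `^ (alpha * beta).
have taule : tau <= tau0 by rewrite ler_piMr ?(ltW tau00).
have fourh : 0 < (4 * h) ^+ d by rewrite exprn_gt0// mulr_gt0.
have [m [mq qm]] := exists_truncation (divr_gt0 Kp0 fourh).
have mpack : m%:R * (4 * h) ^+ d < c0 * (2 * rho / d%:R) ^+ d.
  by rewrite -ltr_pdivlMr.
have rr0 : 0 < rho <= r0 by rewrite rho0.
have [z [zA zsep]] := packing d0 mA rA Ax0 (ltW c00) rr0 h0 mpack.
have hh0 : 0 < h / 2 by rewrite divr_gt0.
have hh1 : h / 2 <= h by rewrite ler_pdivrMr// ler_peMr ?ler1n// ltW.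
(* There are at least half of [Kp / (4 * h) ^+ d] cores, each of volume at least
   [c0 * (h / d) ^+ d]; the powers of [h] cancel. *)
have core_ge : (kappa%:E <= \sum_j lebesgue_rV (core A h z j))%E.
  apply: (@le_trans _ _ (\sum_(j < m.+1) (c0 * (h / d%:R) ^+ d)%:E)%E).
    rewrite sumEFin lee_fin sumr_const card_ord -(mulr_natl _ m.+1).
    apply: (@le_trans _ _ (Kp / (4 * h) ^+ d / 2 * (c0 * (h / d%:R) ^+ d))); last first.
      by rewrite ler_wpM2r// mulr_ge0 ?(ltW c00)// exprn_ge0// divr_ge0 ?ltW.
    rewrite /kappa le_eqVlt; apply/orP; left; apply/eqP.
    rewrite !exprMn exprVn; field.
    have nz (y : R) : 0 < y -> y ^+ d != 0 by move=> y0; rewrite expf_neq0// gt_eqF.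
    by rewrite !nz.
  apply: lee_sum => j _.
  have hr : 0 < h / 2 <= r0 by rewrite hh0 (le_trans hh1)// (le_trans hrho).
  apply: le_trans (rA _ _ hr (zA j).1).
  rewrite EFinM lee_wpmul2l ?lee_fin ?(ltW c00)//.
  apply: le_trans (lebesgue_eball_ge (z j) d0 (ltW hh0)).
  by rewrite lee_fin mulrCA divff// mulr1.
have bpos : 0 <= b by rewrite mulr_ge0 ?ltW.
have tpos : 0 <= tau by rewrite mulr_ge0 ?ltW.
have tau_margin : tau <= C0 * (b * c ^+ d / 2) `^ alpha.
  have -> : b * c ^+ d / 2 = h `^ beta * bc by rewrite /b /bc; ring.
  rewrite powRM ?(ltW hb0) ?(ltW bc0)// -powRrM (mulrC beta) /tau.
  by rewrite mulrCA [leRHS]mulrC ler_wpM2r// ltW.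
have hL : Cst * b / h `^ beta <= L.
  by rewrite /b mulrA mulfK ?gt_eqF.
have hn2 : n%:R * (tau * b ^+ 2 * (2 * h) ^+ d) <= 2^-1.
  have -> : n%:R * (tau * b ^+ 2 * (2 * h) ^+ d) =
      tau0 * b0 ^+ 2 * 2 ^+ d *
      (n%:R * (h `^ (alpha * beta) * (h `^ beta) ^+ 2 * h ^+ d)).
    by rewrite /tau /b !exprMn; ring.
  apply: (@le_trans _ _ (tau0 * b0 ^+ 2 * 2 ^+ d)).
    by rewrite ler_piMr// !mulr_ge0 ?exprn_ge0 ?ltW.
  apply: (@le_trans _ _ (2^-1 ^+ d.+1 * 1 * 2 ^+ d)).
    apply: ler_wpM2r; first exact: exprn_ge0.
    apply: ler_pM => //; [exact: ltW|exact: sqr_ge0|].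
    by rewrite exprn_ile1// ltW.
  by rewrite mulr1 exprSr mulrAC -exprMn mulVf// expr1n mul1r.
have tau1 : tau <= 1 by exact: le_trans taule tau01.
have taumu : tau <= mumax by exact: le_trans taule tau0mu.
have b1 : b <= 1 by apply: mulr_ile1 => //; exact: ltW.
apply: le_trans (lower_bound_at_scale alpha0 C00 tF HC cA AK rA rho0 rho4 h0 hrho
  tpos tau1 taumu (fun j => (zA j).2) zsep v0 v1 Vv bpos b1 tau_margin hL cf hn2).
have k0 : 0 <= tau * (b * c ^+ d).
  by rewrite mulr_ge0// mulr_ge0// exprn_ge0// ltW.
apply: (@le_trans _ _ ((16^-1)%:E * ((tau * (b * c ^+ d))%:E * kappa%:E))%E).
  rewrite -!EFinM lee_fin -[leLHS]mulrA -hrate le_eqVlt; apply/orP; left; apply/eqP.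
  by rewrite /tau /b; ring.
by rewrite lee_wpmul2l ?lee_fin// lee_wpmul2l ?lee_fin.
Qed.
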